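(* Let $a<b$, let $\mu$ be a Borel probability measure on $[a,b]$ that is absolutely continuous with respect to Lebesgue measure, and suppose $p_1,p_2\in[1,\infty]$ are such that $\mu\in L^{p_1}\cap L^{-p_2}$. Then the following hold. (i) If $p_1,p_2<\infty$, then for every $\theta\in(0,1)$ $$\dim_{\mathrm A}^{\theta}\mu\leq 1+\frac{p_1+\theta p_2}{p_1p_2(1-\theta)}\qquad\text{and}\qquad \dim_{\mathrm L}^{\theta}\mu\geq 1-\frac{\theta p_1+p_2}{p_1p_2(1-\theta)}.$$ (ii) If $p_1=p_2=\infty$, then $\mu$ is $1$-Ahlfors regular and $\dim_{\mathrm A}\mu=\dim_{\mathrm L}\mu=1$. (iii) If $p_1<\infty$ and $p_2=\infty$, then for every $\theta\in(0,1)$, $\dim_{\mathrm A}^{\theta}\mu\leq 1+\frac{\theta}{p_1(1-\theta)}$ and $\dim_{\mathrm L}^{\theta}\mu\geq 1-\frac{1}{p_1(1-\theta)}$. If $p_1=\infty$ and $p_2<\infty$, then for every $\theta\in(0,1)$, $\dim_{\mathrm A}^{\theta}\mu\leq 1+\frac{1}{p_2(1-\theta)}$ and $\dim_{\mathrm L}^{\theta}\mu\geq 1-\frac{\theta}{p_2(1-\theta)}$. Moreover, these bounds are sharp in the following sense. With the convention $1/\infty=0$, for all $p_1,p_2\in(1,\infty]$: (a) there exist a compact interval and an absolutely continuous probability measure $\mu$ on it such that $\mu\in L^{p_1'}\cap L^{-p_2'}$ for all $p_1'\in[1,p_1)$ and $p_2'\in[1,p_2)$, and $$\dim_{\mathrm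 A}^{\theta}\mu=1+\frac{1/p_2+\theta/p_1}{1-\theta}\qquad\text{for all }\theta\in(0,1);$$ (b) there exist a compact interval and an absolutely continuous probability measure $\mu$ on it such that $\mu\in L^{p_1'}\cap L^{-p_2'}$ for all $p_1'\in[1,p_1)$ and $p_2'\in[1,p_2)$, and $$\dim_{\mathrm L}^{\theta}\mu=\max\left\{1-\frac{\theta/p_2+1/p_1}{1-\theta},\ 0\right\}\qquad\text{for all }\theta\in(0,1).$$
   Context: Let $\mu$ be a Borel probability measure on a compact metric space, with support $\operatorname{supp}\mu$, and let $B(x,r)$ denote the ball of centre $x$ and radius $r$. The Assouad dimension of $\mu$ is $$\dim_{\mathrm A}\mu=\inf\Big\{\alpha:\ \exists C>0\ \forall\,0<r<R<1\ \forall x\in\operatorname{supp}\mu,\ \tfrac{\mu(B(x,R))}{\mu(B(x,r))}\leq C\left(\tfrac Rr\right)^{\alpha}\Big\}$$ and the lower dimension is $$\dim_{\mathrm L}\mu=\sup\Big\{\alpha:\ \exists C>0\ \forall\,0<r<R<1\ \forall x\in\operatorname{supp}\mu,\ \tfrac{\mu(B(x,R))}{\mu(B(x,r))}\geq C\left(\tfrac Rr\right)^{\alpha}\Big\}.$$ For $\theta\in(0,1)$ the Assouad spectrum and lower spectrum are $$\dim_{\mathrm A}^{\theta}\mu=\inf\Big\{\alpha:\ \exists C>0\ \forall\,0<R<1\ \forall x\in\operatorname{supp}\mu,\ \tfrac{\mu(B(x,R))}{\mu(B(x,R^{1/\theta}))}\leq C\Big(\tfrac{R}{R^{1/\theta}}\Big)^{\alpha}\Big\},$$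 $$\dim_{\mathrm L}^{\theta}\mu=\sup\Big\{\alpha:\ \exists C>0\ \forall\,0<R<1\ \forall x\in\operatorname{supp}\mu,\ \tfrac{\mu(B(x,R))}{\mu(B(x,R^{1/\theta}))}\geq C\Big(\tfrac{R}{R^{1/\theta}}\Big)^{\alpha}\Big\}.$$ Let $\mu$ be absolutely continuous on a compact interval $X$ with density $f$ with respect to Lebesgue measure. For $p\in[1,\infty)$, $\mu\in L^p$ means $\int_X f^p\,dx<\infty$, and $\mu\in L^\infty$ means that $f$ is essentially bounded. For $p\in[1,\infty)$, $\mu\in L^{-p}$ means that $E=\{x\in X: f(x)=0\}$ has Lebesgue measure zero and $\int_{X\setminus E} f(x)^{-p}\,dx<\infty$. $\mu\in L^{-\infty}$ means that $E$ has Lebesgue measure zero and $1/f$ is essentially bounded. $\mu$ is $1$-Ahlfors regular if there is $c\geq1$ with $c^{-1}r\leq\mu(B(x,r))\leq cr$ for all $x\in\operatorname{supp}\mu$ and $r\in(0,1)$. *)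

(* Defs.v *)
From HB Require Import structures.
From mathcomp Require Import all_boot all_order all_algebra.
From mathcomp Require Import all_classical all_reals all_analysis.

Set Implicit Arguments.
Unset Strict Implicit.
Unset Printing Implicit Defensive.

Import Order.TTheory GRing.Theory Num.Theory.
Import numFieldNormedType.Exports.

Local Open Scope classical_set_scope.
Local Open Scope ring_scope.
Local Open Scope ereal_scope.
Local Open Scope charge_scope.

Section dimensions.
Context {R : realType} {T : pseudoMetricType R}.
Implicit Type mu : set T -> \bar R.

Definition msupport mu : set T :=
  [set x | forall r : R, (0 < r)%R -> 0 < mu (ball x r)].

Definition assouad_dim mu : \bar R :=
  ereal_inf [set a%:E | a in [set a : R | exists2 C : R, (0 < C)%R &
    forall r s : R, (0 < r)%R -> (r < s)%R -> (s < 1)%R ->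
    forall x, msupport mu x ->
      mu (ball x s) / mu (ball x r) <= (C * (s / r) `^ a)%:E]].

Definition lower_dim mu : \bar R :=
  ereal_sup [set a%:E | a in [set a : R | exists2 C : R, (0 < C)%R &
    forall r s : R, (0 < r)%R -> (r < s)%R -> (s < 1)%R ->
    forall x, msupport mu x ->
      (C * (s / r) `^ a)%:E <= mu (ball x s) / mu (ball x r)]].

Definition assouad_spectrum (t : R) mu : \bar R :=
  ereal_inf [set a%:E | a in [set a : R | exists2 C : R, (0 < C)%R &
    forall s : R, (0 < s)%R -> (s < 1)%R ->
    forall x, msupport mu x ->
      mu (ball x s) / mu (ball x (s `^ (1 / t))) <=
        (C * (s / s `^ (1 / t)) `^ a)%:E]].

Definition lower_spectrum (t : R) mu : \bar R :=
  ereal_sup [set a%:E | a in [set a : R | exists2 C : R, (0 < C)%R &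
    forall s : R, (0 < s)%R -> (s < 1)%R ->
    forall x, msupport mu x ->
      (C * (s / s `^ (1 / t)) `^ a)%:E <=
        mu (ball x s) / mu (ball x (s `^ (1 / t)))]].

Definition ahlfors_regular1 mu : Prop :=
  exists2 c : R, (1 <= c)%R &
    forall x, msupport mu x -> forall r : R, (0 < r)%R -> (r < 1)%R ->
      (c^-1 * r)%:E <= mu (ball x r) <= (c * r)%:E.

End dimensions.

Section densities.
Context {R : realType}.
Implicit Types (a b : R) (mu : probability (measurableTypeR R) R) (p : \bar R).

(* A Borel measure on [a, b] is represented by its extension by zero to R:
   for x in [a, b] the balls of R and of [a, b] then have the same mass. *)
Definition ac_on a b mu : Prop :=
  mu `[a, b]%classic = 1 /\ mu `<< lebesgue_measure.

(* When mu `<< lebesgue_measure the Radon-Nikodym derivative is finite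
   everywhere, so that [fine] loses nothing, and nonnegative almost everywhere. *)
Definition density mu (x : R) : R :=
  fine (('d (charge_of_finite_measure mu) '/d lebesgue_measure) x).

Definition Lpos a b mu p : Prop :=
  match p with
  | r%:E => \int[lebesgue_measure]_(x in `[a, b]) (density mu x `^ r)%:E < +oo
  | +oo => exists M : R, {ae lebesgue_measure, forall x : R,
             `[a, b]%classic x -> (density mu x <= M)%R}
  | -oo => False
  end.

Definition density_zeros a b mu : set R :=
  [set x | `[a, b]%classic x /\ density mu x = 0%R].

Definition Lneg a b mu p : Prop :=
  lebesgue_measure (density_zeros a b mu) = 0 /\
  match p with
  | r%:E => \int[lebesgue_measure]_(x in `[a, b] `\` density_zeros a b mu)
              (density mu x `^ (- r))%:E < +oo
  | +oo => exists M : R, {ae lebesgue_measure, forall x : R,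
             (`[a, b] `\` density_zeros a b mu)%classic x ->
             ((density mu x)^-1 <= M)%R}
  | -oo => False
  end.

End densities.

(* Main.v *)
Require Import Defs.
From HB Require Import structures.
From mathcomp Require Import all_boot all_order all_algebra.
From mathcomp Require Import all_classical all_reals all_analysis.
From mathcomp Require Import measurable_realfun ring lra.
Import Order.TTheory GRing.Theory Num.Theory.
Import numFieldNormedType.Exports.
Local Open Scope classical_set_scope.
Local Open Scope ring_scope.

Set Implicit Arguments.
Unset Strict Implicit.

(** Write [u = 1 / p1] and [w = 1 / p2].

Upper bounds for the Assouad spectrum and lower bounds for the lower spectrum
only depend on two-sided bounds for the masses of balls,
[c * r `^ (1 + w) <= mu (ball x r) <= C * r `^ (1 - u)]
([ball_mass_bounds]): inserting [s] and [s `^ (1 / t)] for [r] gives exactly the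
announced powers of [s / s `^ (1 / t)]. The upper mass bound is Hoelder's
inequality and the lower one is its reverse form; both are obtained here by
cutting the density at a level depending on [r], which reduces them to the
pointwise inequalities [le_level_add_powR] and [one_le_level_add_powR]
([ball_mass_le_of_Lq], [ball_mass_ge_of_Lq]). If both exponents are infinite,
the mass of a ball is comparable to its radius and both dimensions equal [1]
([ahlfors_regular1_dims]).

For sharpness, all the action takes place at the point [0] of [[0, 1]]. A
density equal to [x `^ (- u)] on a set [V] and to [x `^ w] off [V] has the
required integrability for every [V], since it lies between these two powers
([two_power_Lpos], [two_power_Lneg]). The set [V] then decides at which scales
the mass near [0] is as large, or as small, as the mass bounds permit. The
Assouad spectrum requires a large mass at a scale [s] and a small one at
[s `^ (1 / t)], the lower spectrum the opposite ([assouad_extremal],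
[lower_extremal]). Taking the scales [s = 2^-1 ^+ n`!] lets one set [V] serve
all [t]: the next scale [s ^+ n.+1] is eventually far below [s `^ (1 / t)]. The
matching bounds on the other side follow from the general ones by letting the
exponents of integrability tend to [p1] and [p2] ([spectra_bounds_of_Lpq_lt]). *)

(** * Spectra from the masses of balls *)

Lemma ratio_le {R : realType} {m n : \bar R} {a b : R} :
  0 < b -> (0 <= m)%E -> (m <= a%:E)%E -> (b%:E <= n)%E ->
  (m / n <= (a / b)%:E)%E.
Proof.
move=> b0 m0 ma bn; have a0 : 0 <= a by rewrite -lee_fin (le_trans m0).
rewrite EFinM; apply: lee_pmul => //.
  by rewrite inve_ge0 (le_trans _ bn)// lee_fin ltW.
case: n bn => [n| |//].
  rewrite lee_fin => bn; have n0 := lt_le_trans b0 bn.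
  by rewrite inver gt_eqF// lee_fin lef_pV2.
by rewrite invey => _; rewrite lee_fin invr_ge0 ltW.
Qed.

Lemma le_ratio {R : realType} {m n : \bar R} {a b : R} :
  0 <= a -> 0 < b -> (0 < n)%E -> (a%:E <= m)%E -> (n <= b%:E)%E ->
  ((a / b)%:E <= m / n)%E.
Proof.
move=> a0 b0 n0 am nb; rewrite EFinM; apply: lee_pmul => //.
  by rewrite lee_fin invr_ge0 ltW.
case: n n0 nb => [n| |//]; last by rewrite leye_eq.
rewrite lte_fin lee_fin => n0 nb.
by rewrite inver gt_eqF// lee_fin lef_pV2.
Qed.

Lemma powR_self_ratio {R : realType} (s t a : R) : 0 < s ->
  (s / s `^ (1 / t)) `^ a = s `^ ((1 - 1 / t) * a).
Proof.
move=> s0; rewrite [RHS]powRrM; congr (_ `^ _).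
by rewrite powRB ?(gt_eqF s0) ?implybT// powRr1// ltW.
Qed.

Lemma powR_lt1 {R : realType} (s a : R) : 0 < a -> 0 < s -> s < 1 -> s `^ a < 1.
Proof.
move=> a0 s0 s1; have -> : 1 = 1 `^ a :> R by rewrite powR1.
by apply: gt0_ltr_powR; rewrite ?nnegrE ?(ltW s0).
Qed.

(** Otherwise [y `^ (a - b)] would be bounded along an unbounded set. *)
Lemma powR_exponent_le {R : realType} (K a b : R) :
  (forall M : R, exists2 y, M <= y & y `^ a <= K * y `^ b) -> a <= b.
Proof.
move=> H; rewrite leNgt; apply/negP => ba.
have d0 : 0 < a - b by rewrite subr_gt0.
have [y My yK] := H (Num.max 1 ((`|K| + 1) `^ (a - b)^-1)).
have y0 : 0 < y by apply: lt_le_trans My; rewrite lt_max ltr01.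
have My' : (`|K| + 1) `^ (a - b)^-1 <= y.
  by apply: le_trans My; rewrite le_max lexx orbT.
have K1 : 0 <= `|K| + 1 :> R by rewrite addr_ge0.
have : `|K| + 1 <= y `^ (a - b).
  have -> : `|K| + 1 = ((`|K| + 1) `^ (a - b)^-1) `^ (a - b).
    by rewrite -powRrM mulVf ?gt_eqF// powRr1.
  by apply: ge0_ler_powR; rewrite ?nnegrE ?powR_ge0 ?(ltW d0) ?(ltW y0)// My'.
have yb : 0 < y `^ b by rewrite powR_gt0.
have : y `^ (a - b) <= K.
  by rewrite powRB ?(gt_eqF y0) ?implybT// ler_pdivrMr.
by have := ler_norm K; lra.
Qed.

(** The information on [mu] from which its spectra are bounded; [v] and [w] stand
for the reciprocals of the exponents of integrability of the density and of its
inverse. *)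
Definition ball_mass_bounds {R : realType} (mu : set R -> \bar R) (v w : R) :=
  exists2 C : R, 0 < C & exists2 c : R, 0 < c &
    forall x, msupport mu x -> forall r : R, 0 < r -> r < 1 ->
      ((c * r `^ (1 + w))%:E <= mu (ball x r))%E /\
      (mu (ball x r) <= (C * r `^ (1 - v))%:E)%E.

(** With [r = s `^ (1 / t)], the ratio of masses is at most a constant times
[s `^ (1 - v) / r `^ (1 + w)], and this is a power of [s] alone, hence of
[s / r]. *)
Lemma assouad_spectrum_le {R : realType} (mu : set R -> \bar R) (v w t : R) :
  (forall A, 0 <= mu A)%E -> 0 < t < 1 -> ball_mass_bounds mu v w ->
  (assouad_spectrum t mu <= (1 + (w + t * v) / (1 - t))%:E)%E.
Proof.
move=> mu0 /andP[t0 t1] [C C0 [c c0 H]].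
apply: ge_ereal_inf; exists (1 + (w + t * v) / (1 - t))%:E => //=.
exists (1 + (w + t * v) / (1 - t)) => //; exists (C / c); first exact: divr_gt0.
move=> s s0 s1 x sx; set r := s `^ (1 / t).
have r0 : 0 < r by rewrite powR_gt0.
have r1 : r < 1 by apply: powR_lt1; rewrite ?divr_gt0.
have [_ ub] := H x sx s s0 s1; have [lb _] := H x sx r r0 r1.
apply: (le_trans (ratio_le _ _ ub lb)) => //; first by rewrite mulr_gt0// powR_gt0.
rewrite powR_self_ratio// /r -powRrM lee_fin le_eqVlt; apply/orP; left; apply/eqP.
rewrite invfM mulrACA; congr (_ * _); rewrite -powRB ?(gt_eqF s0) ?implybT//.
by congr (_ `^ _); field; rewrite subr_eq0 !gt_eqF.
Qed.

Lemma le_lower_spectrum {R : realType} (mu : set R -> \bar R) (v w t : R) :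
  0 < t < 1 -> ball_mass_bounds mu v w ->
  ((1 - (t * w + v) / (1 - t))%:E <= lower_spectrum t mu)%E.
Proof.
move=> /andP[t0 t1] [C C0 [c c0 H]].
apply: ereal_sup_ubound; exists (1 - (t * w + v) / (1 - t)) => //.
exists (c / C); first exact: divr_gt0.
move=> s s0 s1 x sx; set r := s `^ (1 / t).
have r0 : 0 < r by rewrite powR_gt0.
have r1 : r < 1 by apply: powR_lt1; rewrite ?divr_gt0.
have [lb _] := H x sx s s0 s1; have [_ ub] := H x sx r r0 r1.
apply: le_trans (le_ratio _ _ _ lb ub); last 3 first.
- by rewrite mulr_ge0 ?powR_ge0 ?ltW.
- by rewrite mulr_gt0// powR_gt0.
- exact: sx.
rewrite powR_self_ratio// /r -powRrM lee_fin le_eqVlt; apply/orP; left; apply/eqP.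
rewrite invfM mulrACA; congr (_ * _); rewrite -powRB ?(gt_eqF s0) ?implybT//.
by congr (_ `^ _); field; rewrite subr_eq0 !gt_eqF.
Qed.

(** The exponent [0] is admissible because [mu] is monotone. *)
Lemma lower_spectrum_ge0 {R : realType} (mu : probability (measurableTypeR R) R)
  (t : R) : 0 < t < 1 -> (0 <= lower_spectrum t (mu : set R -> \bar R))%E.
Proof.
move=> /andP[t0 t1]; apply: ereal_sup_ubound; exists 0 => //; exists 1 => //.
move=> s s0 s1 x sx; rewrite powRr0 mulr1.
set r := s `^ (1 / t); have rs : r <= s.
  rewrite /r ge1r_powR//; first by rewrite s0 ltW.
  by rewrite ler_pdivlMr// mul1r ltW.
have mr : (mu (ball x r) <= mu (ball x s))%E.
  by apply: le_measure; rewrite ?inE;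
    [by rewrite ball_itv; exact: measurable_itv..|exact: le_ball].
have pr : (0 < mu (ball x r))%E by apply: sx; rewrite powR_gt0.
have fr : mu (ball x r) = (fine (mu (ball x r)))%:E.
  by rewrite fineK// fin_num_measure// ball_itv; exact: measurable_itv.
rewrite fr in mr pr *; rewrite lte_fin in pr.
by apply: le_trans (le_ratio _ _ _ mr (lexx _)); rewrite ?divff ?gt_eqF// ltW.
Qed.

Lemma self_ratio_unbounded {R : realType} (t M : R) : 0 < t < 1 ->
  exists2 d : R, 0 < d & forall s, 0 < s -> s < d -> M <= s / s `^ (1 / t).
Proof.
move=> /andP[t0 t1].
have e0 : 0 < 1 / t - 1 by rewrite subr_gt0 ltr_pdivlMr// mul1r.
set N := Num.max M 1; have N0 : 0 < N by rewrite lt_max ltr01 orbT.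
exists (N `^ (- (1 / t - 1)^-1)); first exact: powR_gt0.
move=> s s0 sd.
have -> : s / s `^ (1 / t) = s `^ (1 - 1 / t).
  have := powR_self_ratio t 1 s0; rewrite mulr1 => <-.
  by rewrite powRr1// divr_ge0 ?powR_ge0 ?ltW.
apply: (@le_trans _ _ N); first by rewrite le_max lexx.
have NE : (- (1 / t - 1)^-1) * (1 - 1 / t) = 1.
  by rewrite -(opprB (1 / t)) mulrNN mulVf// gt_eqF.
rewrite -[leLHS](powRr1 (ltW N0)) -[X in N `^ X]NE.
rewrite powRrM -(opprB (1 / t)) [X in X <= _]powRN [leRHS]powRN lef_pV2 ?posrE ?powR_gt0//.
by apply: ge0_ler_powR; rewrite ?nnegrE ?powR_ge0 ?(ltW e0) ?(ltW s0) ?(ltW sd).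
Qed.

(** As [s / s `^ (1 / t)] is unbounded for small [s], large ratios of masses at
arbitrarily small scales, at centres that may vary, bound every admissible
exponent from below. *)
Lemma le_assouad_spectrum {R : realType} (mu : set R -> \bar R) (t K a : R) :
  0 < t < 1 -> 0 < K ->
  (forall d : R, 0 < d -> exists s x : R, [/\ 0 < s, s < d, s < 1, msupport mu x &
     ((K * (s / s `^ (1 / t)) `^ a)%:E <=
        mu (ball x s) / mu (ball x (s `^ (1 / t))))%E]) ->
  (a%:E <= assouad_spectrum t mu)%E.
Proof.
move=> t01 K0 H; apply/ereal_infP => _ [b [C C0 bC] <-]; rewrite lee_fin.
apply: (@powR_exponent_le _ (C / K)) => M.
have [d d0 Hd] := self_ratio_unbounded M t01.
have [s [x [s0 sd s1 sx Hs]]] := H d d0.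
exists (s / s `^ (1 / t)); first exact: Hd.
rewrite mulrAC ler_pdivlMr// mulrC -lee_fin.
exact: le_trans Hs (bC s s0 s1 x sx).
Qed.

Lemma lower_spectrum_le {R : realType} (mu : set R -> \bar R) (t K a : R) :
  0 < t < 1 -> 0 < K ->
  (forall d : R, 0 < d -> exists s x : R, [/\ 0 < s, s < d, s < 1, msupport mu x &
     (mu (ball x s) / mu (ball x (s `^ (1 / t))) <=
      (K * (s / s `^ (1 / t)) `^ a)%:E)%E]) ->
  (lower_spectrum t mu <= a%:E)%E.
Proof.
move=> t01 K0 H; apply: ge_ereal_sup => _ [b [C C0 bC] <-]; rewrite lee_fin.
apply: (@powR_exponent_le _ (K / C)) => M.
have [d d0 Hd] := self_ratio_unbounded M t01.
have [s [x [s0 sd s1 sx Hs]]] := H d d0.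
exists (s / s `^ (1 / t)); first exact: Hd.
rewrite mulrAC ler_pdivlMr// mulrC -lee_fin.
exact: le_trans (bC s s0 s1 x sx) Hs.
Qed.

(** * Densities *)

(** A Radon-Nikodym derivative is nonnegative only almost everywhere. The
estimates below use a version that is finite and nonnegative everywhere, which
keeps null sets out of the pointwise inequalities. *)
Record is_density {R : realType} (mu : set R -> \bar R) (g : R -> R) : Prop :=
  IsDensity {
    density_measurable : measurable_fun [set: R] g ;
    density_ge0 : forall x, 0 <= g x ;
    density_integral : forall A : set (measurableTypeR R), measurable A ->
      mu A = (\int[@lebesgue_measure R]_(x in A) (g x)%:E)%E }.

Lemma exists_density {R : realType} (mu : probability (measurableTypeR R) R) :
  mu `<< @lebesgue_measure R -> exists g, is_density mu g.
Proof.
move=> mul; pose f : R -> \bar R := Radon_Nikodym_SigmaFinite.f mu (@lebesgue_measure R).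
have fE x : f x = (fine (f x))%:E.
  by rewrite fineK// Radon_Nikodym_SigmaFinite.f_fin_num.
have mf : measurable_fun [set: R] f.
  exact: (measurable_int _ (Radon_Nikodym_SigmaFinite.f_integrable mul)).
exists (fine \o f); split.
- exact: measurableT_comp.
- by move=> x; rewrite fine_ge0// Radon_Nikodym_SigmaFinite.f_ge0.
- move=> A mA; rewrite (Radon_Nikodym_SigmaFinite.f_integral mul mA).
  by apply: eq_integral => x _; exact: fE.
Qed.

Lemma density_ae_eq {R : realType} (mu : probability (measurableTypeR R) R) g :
  mu `<< @lebesgue_measure R -> is_density mu g ->
  {ae @lebesgue_measure R, forall x, density mu x = g x}.
Proof.
move=> mul [mg g0 gE].
pose h : R -> \bar R :=
  Radon_Nikodym (charge_of_finite_measure mu) (@lebesgue_measure R).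
have ih : (@lebesgue_measure R).-integrable setT h by exact: Radon_Nikodym_integrable.
have hg : ae_eq (@lebesgue_measure R) setT h (EFin \o g).
  apply: integral_ae_eq => //; first exact/measurable_EFinP.
  move=> E _ mE; rewrite -gE//.
  exact: esym (@Radon_Nikodym_integral _ _ _ (charge_of_finite_measure mu)
    (@lebesgue_measure R) E mul mE).
by apply: filterS hg => x /(_ I); rewrite /density /h /= => ->.
Qed.

Lemma measurable_density {R : realType} (mu : probability (measurableTypeR R) R) :
  mu `<< @lebesgue_measure R ->
  measurable_fun [set: R] (density mu).
Proof.
move=> mul; apply: measurableT_comp => //.
exact: (measurable_int _ (@Radon_Nikodym_integrable _ _ _
  (charge_of_finite_measure mu) (@lebesgue_measure R) mul)).
Qed.

Lemma integral_density_powR {R : realType}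
    (mu : probability (measurableTypeR R) R) g (A : set R) (q : R) :
  mu `<< @lebesgue_measure R -> is_density mu g -> measurable A ->
  (\int[@lebesgue_measure R]_(x in A) (density mu x `^ q)%:E =
   \int[@lebesgue_measure R]_(x in A) (g x `^ q)%:E)%E.
Proof.
move=> mul dg mA; have dE := density_ae_eq mul dg.
have mp (h : R -> R) : measurable_fun [set: R] h ->
    measurable_fun A (fun x => (h x `^ q)%:E).
  move=> mh; apply/measurable_EFinP/measurable_funTS.
  by apply: (measurableT_comp (measurable_powR q)).
apply: ge0_ae_eq_integral => //.
- exact: mp (measurable_density mul).
- exact: mp (density_measurable dg).
- by move=> x _; rewrite lee_fin powR_ge0.
- by move=> x _; rewrite lee_fin powR_ge0.
- move: dE; rewrite /ae_eq.
  by apply: (@filterS _ (almost_everywhere (@lebesgue_measure R)) _) => x -> _.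
Qed.

(** * Masses of balls from integrability of the density *)

Lemma ge0_integral_lincomb {R : realType} (A : set R) (h k : R -> R) (c d : R) :
  measurable A -> measurable_fun [set: R] h -> measurable_fun [set: R] k ->
  (forall x, 0 <= h x) -> (forall x, 0 <= k x) -> 0 <= c -> 0 <= d ->
  (\int[@lebesgue_measure R]_(x in A) (c * h x + d * k x)%:E =
   c%:E * \int[@lebesgue_measure R]_(x in A) (h x)%:E +
   d%:E * \int[@lebesgue_measure R]_(x in A) (k x)%:E)%E.
Proof.
move=> mA mh mk h0 k0 c0 d0.
have mEF (f : R -> R) : measurable_fun [set: R] f ->
    measurable_fun A (EFin \o f).
  by move=> mf; apply/measurable_EFinP/measurable_funTS.
have mM (f : R -> R) e : measurable_fun [set: R] f ->
    measurable_fun A (fun x => e%:E * (f x)%:E)%E.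
  by move=> mf; apply: measurable_funeM; exact: mEF.
under eq_integral do rewrite EFinD !EFinM.
rewrite ge0_integralD//; first last.
- exact: mM.
- by move=> x _; rewrite mule_ge0 ?lee_fin.
- exact: mM.
- by move=> x _; rewrite mule_ge0 ?lee_fin.
rewrite !ge0_integralZl_EFin//.
- by move=> x _; rewrite lee_fin.
- exact: mEF.
- by move=> x _; rewrite lee_fin.
- exact: mEF.
Qed.

(** Cutting at the level [l]: if [l < x] then [x / l <= (x / l) `^ q]. *)
Lemma le_level_add_powR {R : realType} (x l q : R) : 0 <= x -> 0 < l -> 1 <= q ->
  x <= l + l `^ (1 - q) * x `^ q.
Proof.
move=> x0 l0 q1; have [xl|lx] := leP x l.
  by apply: ler_wpDr => //; rewrite mulr_ge0 ?powR_ge0.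
have xl1 : 1 <= x / l by rewrite ler_pdivlMr// mul1r ltW.
have := le1r_powR xl1 q1; rewrite ler_pdivrMr// => /le_trans; apply.
rewrite powRM ?invr_ge0 ?(ltW l0)// -powR_inv1 ?(ltW l0)// -powRrM mulN1r.
rewrite -mulrA -[X in _ * (_ * X)](powRr1 (ltW l0)) -powRD ?(gt_eqF l0) ?implybT//.
by rewrite mulrC (addrC (- q)) ler_wpDl// ltW.
Qed.

(** Cutting at the level [l]: if [x < l] then [1 <= (l / x) `^ q]. *)
Lemma one_le_level_add_powR {R : realType} (x l q : R) : 0 < x -> 0 < l -> 0 < q ->
  1 <= l^-1 * x + l `^ q * x `^ (- q).
Proof.
move=> x0 l0 q0; have [lx|xl] := leP l x.
  by rewrite ler_wpDr ?mulr_ge0 ?powR_ge0// mulrC ler_pdivlMr// mul1r.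
apply: ler_wpDl; first by rewrite mulr_ge0 ?invr_ge0 ?ltW.
rewrite powRN ler_pdivlMr ?powR_gt0// mul1r.
by rewrite ge0_ler_powR ?nnegrE ?ltW.
Qed.

(** From a centre in [[a, b]], the half of the ball that points towards the
midpoint of [[a, b]] stays in the interval at least up to length [(b - a) / 2]. *)
Lemma ball_cap_itv_measure {R : realType} (a b x r : R) :
  a < b -> a <= x <= b -> 0 < r -> r < 1 ->
  ((Num.min 1 ((b - a) / 2) * r)%:E <=
     @lebesgue_measure R (ball x r `&` `[a, b]))%E.
Proof.
move=> ab /andP[ax xb] r0 r1; rewrite ball_itv; set c := Num.min _ _.
have [c1 c2] : c <= 1 /\ c <= (b - a) / 2 by rewrite !ge_min !lexx ?orbT.
have c0 : 0 < c by rewrite lt_min ltr01 divr_gt0// subr_gt0.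
have cr0 : 0 < c * r by rewrite mulr_gt0.
have crr : c * r <= r by nra.
have crb : c * r <= (b - a) / 2 by nra.
have mI : measurable (`]x - r, x + r[ `&` `[a, b] : set R).
  by apply: measurableI; exact: measurable_itv.
have [xm|mx] := leP x ((a + b) / 2).
- have -> : ((c * r)%:E = @lebesgue_measure R `]x, (x + c * r)%R[)%E.
    by rewrite lebesgue_measure_itv/= lte_fin ltrDl cr0 -EFinB addrAC subrr add0r.
  apply: le_measure; rewrite ?inE//.
  move=> y /=; rewrite !in_itv/= => /andP[y1 y2]; split; apply/andP; split; lra.
- have -> : ((c * r)%:E = @lebesgue_measure R `](x - c * r)%R, x[)%E.
    rewrite lebesgue_measure_itv/= lte_fin ifT; last by rewrite ltrBlDr ltrDl.
    by rewrite -EFinB opprB addrC subrK.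
  apply: le_measure; rewrite ?inE//.
  move=> y /=; rewrite !in_itv/= => /andP[y1 y2]; split; apply/andP; split; lra.
Qed.

Lemma measure_itv_cap {R : realType} (mu : probability (measurableTypeR R) R)
    (a b : R) (A : set R) : mu `[a, b]%classic = 1%E -> measurable A ->
  mu A = mu (A `&` `[a, b]).
Proof.
move=> mu1 mA; have mI : measurable (`[a, b]%classic : set R) by exact: measurable_itv.
have mC0 : mu (~` `[a, b]%classic) = 0%E.
  by rewrite probability_setC//= mu1 subee.
have -> : (mu A = mu (A `\` `[a, b]%classic) + mu (A `&` `[a, b]%classic))%E.
  exact: measureDI.
rewrite (_ : mu (A `\` _) = 0%E) ?add0e//.
apply/eqP; rewrite -measure_le0 -mC0; apply: le_measure; rewrite ?inE.
- exact: measurableD.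
- exact: measurableC.
- by move=> x [].
Qed.

Lemma msupport_itv {R : realType} (mu : probability (measurableTypeR R) R)
    (a b : R) : mu `[a, b]%classic = 1%E ->
  msupport (mu : set R -> \bar R) `<=` `[a, b].
Proof.
move=> mu1 x sx; apply: contrapT => xab.
have [r r0 rab] : exists2 r : R, 0 < r & ball x r `&` `[a, b] = set0.
  have : open (~` `[a, b]%classic : set R) by apply: closed_openC; exact: itv_closed.
  rewrite openE => /(_ x xab) [r /= r0 rb]; exists r => //.
  by apply/seteqP; split => // y [/rb].
have := sx r r0; rewrite (measure_itv_cap mu1) ?rab ?measure0 ?ltxx//.
by rewrite ball_itv; exact: measurable_itv.
Qed.

Lemma measurable_comp_powR {R : realType} (g : R -> R) (q : R) :
  measurable_fun [set: R] g -> measurable_fun [set: R] (fun x => g x `^ q).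
Proof. exact: (measurableT_comp (measurable_powR q)). Qed.

Lemma ge0_lty_fin {R : realType} (x : \bar R) : (0 <= x)%E -> (x < +oo)%E ->
  exists2 r : R, 0 <= r & x = r%:E.
Proof. by case: x => [r| |]// r0 _; exists r. Qed.

(** Hoelder's inequality for the indicator of a ball. Integrating
[le_level_add_powR] gives the bound [l * (2 * r) + l `^ (1 - q) * J], where [J]
is the integral of [g `^ q]. *)
Lemma ball_mass_le_of_Lq {R : realType} (mu : probability (measurableTypeR R) R)
    (g : R -> R) (a b q : R) :
  is_density mu g -> mu `[a, b]%classic = 1%E -> 1 <= q ->
  (\int[@lebesgue_measure R]_(x in `[a, b]) (g x `^ q)%:E < +oo)%E ->
  exists2 C : R, 0 < C & forall x r : R, 0 < r -> r < 1 ->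
    (mu (ball x r) <= (C * r `^ (1 - q^-1))%:E)%E.
Proof.
move=> [mg g0 gE] mu1 q1.
have /ge0_lty_fin /[apply] -[J J0 JE] :
    (0 <= \int[@lebesgue_measure R]_(x in `[a, b]) (g x `^ q)%:E)%E.
  by apply: integral_ge0 => x _; rewrite lee_fin powR_ge0.
have q0 : 0 < q by exact: lt_le_trans q1.
exists (2 + J); first lra.
(* at this level both terms have order [r `^ (1 - q^-1)] *)
move=> x r r0 r1; pose l := r `^ (- q^-1).
have l0 : 0 < l by rewrite powR_gt0.
have mB : measurable (ball x r : set R) by rewrite ball_itv; exact: measurable_itv.
have mI : measurable (`[a, b]%classic : set R) by exact: measurable_itv.
have mBI : measurable (ball x r `&` `[a, b] : set R) by exact: measurableI.
have mgq := measurable_comp_powR q mg.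
rewrite (measure_itv_cap mu1)// gE//.
apply: (@le_trans _ _ (\int[@lebesgue_measure R]_(y in ball x r `&` `[a, b])
    (l * 1 + l `^ (1 - q) * g y `^ q)%:E)%E).
  apply: ge0_le_integral => //.
  - by move=> y _; rewrite lee_fin.
  - exact/measurable_EFinP/measurable_funTS.
  - apply/measurable_EFinP/measurable_funTS/measurable_funD => //.
    exact: measurable_funM.
  - by move=> y _; rewrite lee_fin mulr1 le_level_add_powR.
rewrite (@ge0_integral_lincomb _ _ (cst 1) (fun y => g y `^ q))//; last first.
- by rewrite powR_ge0.
- exact: ltW.
- by move=> y; rewrite powR_ge0.
rewrite (_ : (\int[@lebesgue_measure R]_(y in ball x r `&` `[a, b]) (cst 1 y)%:E =
    @lebesgue_measure R (ball x r `&` `[a, b]))%E); last first.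
  by rewrite -[RHS]mul1e -integral_cst.
apply: (@le_trans _ _ (l%:E * (r *+ 2)%:E + (l `^ (1 - q))%:E * J%:E)%E).
  apply: leeD; apply: lee_wpmul2l; rewrite ?lee_fin ?powR_ge0 ?(ltW l0)//.
    rewrite -(lebesgue_measure_ball x (ltW r0)); apply: le_measure; rewrite ?inE//.
  rewrite -JE; apply: ge0_subset_integral => //.
    exact/measurable_EFinP/measurable_funTS.
  by move=> y _; rewrite lee_fin powR_ge0.
have lr : l * r = r `^ (1 - q^-1).
  by rewrite addrC powRD ?powRr1 ?(ltW r0)// (gt_eqF r0) implybT.
have lq : l `^ (1 - q) = r `^ (1 - q^-1).
  by rewrite /l -powRrM; congr (_ `^ _); field; rewrite gt_eqF.
by rewrite -!EFinM -EFinD lee_fin mulrnAr lr lq; lra.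
Qed.

(** The reverse Hoelder inequality for the indicator of a ball. Integrating
[one_le_level_add_powR] bounds the length of the ball by
[l^-1 * mu (ball x r) + l `^ q * J], where [J] is the integral of
[g `^ (- q)]; a level [l] that makes the second term at most half of this length
leaves a lower bound for the mass. *)
Lemma ball_mass_ge_of_Lq {R : realType} (mu : probability (measurableTypeR R) R)
    (g : R -> R) (a b q : R) :
  is_density mu g -> a < b -> 0 < q ->
  @lebesgue_measure R [set x | `[a, b]%classic x /\ g x = 0] = 0%E ->
  (\int[@lebesgue_measure R]_(x in `[a, b]) (g x `^ (- q))%:E < +oo)%E ->
  exists2 c : R, 0 < c & forall x, a <= x <= b -> forall r : R, 0 < r -> r < 1 ->
    ((c * r `^ (1 + q^-1))%:E <= mu (ball x r))%E.
Proof.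
move=> [mg g0 gE] ab q0 Z0.
have /ge0_lty_fin /[apply] -[J J0 JE] :
    (0 <= \int[@lebesgue_measure R]_(x in `[a, b]) (g x `^ (- q))%:E)%E.
  by apply: integral_ge0 => x _; rewrite lee_fin powR_ge0.
pose d := Num.min 1 ((b - a) / 2).
have d0 : 0 < d by rewrite lt_min ltr01 divr_gt0// subr_gt0.
(* chosen so that [l `^ q * J <= d * r / 2] for the level [l = e * r `^ q^-1] *)
pose e := (d / (2 * (J + 1))) `^ q^-1.
have J1 : 0 < 2 * (J + 1) by lra.
have e0 : 0 < e by rewrite powR_gt0// divr_gt0.
exists (e * d / 2); first by rewrite divr_gt0// mulr_gt0.
move=> x xab r r0 r1; pose l := e * r `^ q^-1.
have l0 : 0 < l by rewrite mulr_gt0// powR_gt0.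
have mB : measurable (ball x r : set R) by rewrite ball_itv; exact: measurable_itv.
have mI : measurable (`[a, b]%classic : set R) by exact: measurable_itv.
have mBI : measurable (ball x r `&` `[a, b] : set R) by exact: measurableI.
have mgq := measurable_comp_powR (- q) mg.
have mZ : measurable [set x | `[a, b]%classic x /\ g x = 0].
  have -> : [set x | `[a, b]%classic x /\ g x = 0] = `[a, b]%classic `&` g @^-1` [set 0].
    by apply/seteqP; split.
  by apply: measurableI => //; rewrite -[X in measurable X]setTI; exact: mg.
have H1 := ball_cap_itv_measure ab xab r0 r1; rewrite -/d in H1.
have H2 : (@lebesgue_measure R (ball x r `&` `[a, b]) <=
   \int[@lebesgue_measure R]_(y in ball x r `&` `[a, b])
    (l^-1 * g y + l `^ q * g y `^ (- q))%:E)%E.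
  rewrite -[leLHS]mul1e -integral_cst//; apply: ae_ge0_le_integral => //.
  - move=> y _; rewrite lee_fin addr_ge0// mulr_ge0 ?powR_ge0 ?invr_ge0 ?(ltW l0)//.
  - apply/measurable_EFinP/measurable_funTS/measurable_funD; exact: measurable_funM.
  - exists [set x | `[a, b]%classic x /\ g x = 0]; split => // y /= /not_implyP[[_ yab]].
    move=> H; split => //; apply: contrapT => gy; apply: H; rewrite lee_fin.
    by apply: one_le_level_add_powR => //; rewrite lt_def g0 andbT; exact/eqP.
rewrite ge0_integral_lincomb// in H2; last 3 first.
- by move=> y; rewrite powR_ge0.
- by rewrite invr_ge0 ltW.
- by rewrite powR_ge0.
rewrite -gE// in H2.
have H3 : (\int[@lebesgue_measure R]_(y in ball x r `&` `[a, b]) (g y `^ (- q))%:E <= J%:E)%E.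
  rewrite -JE; apply: ge0_subset_integral => //.
    exact/measurable_EFinP/measurable_funTS.
  by move=> y _; rewrite lee_fin powR_ge0.
have H4 : (mu (ball x r `&` `[a, b]) <= mu (ball x r))%E.
  by apply: le_measure; rewrite ?inE//.
apply: le_trans H4; move: H2.
have -> : mu (ball x r `&` `[a, b]) = (fine (mu (ball x r `&` `[a, b])))%:E.
  by rewrite fineK// fin_num_measure.
set m := fine _; move=> H2.
have := le_trans H1 (le_trans H2 (leeD (lexx _) (lee_wpmul2l _ H3))).
rewrite lee_fin powR_ge0 => /(_ isT); rewrite -!EFinM -EFinD !lee_fin => H5.
have lq : l `^ q = d / (2 * (J + 1)) * r.
  rewrite powRM ?(ltW e0) ?powR_ge0// -!powRrM mulVf ?gt_eqF// !powRr1 ?(ltW r0)//.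
  by rewrite divr_ge0// ltW.
have H6 : l `^ q * J <= d * r / 2.
  have -> : l `^ q * J = (d * r / 2) * (J / (J + 1)).
    by rewrite lq; field; rewrite gt_eqF//; lra.
  have ? : 0 < d * r / 2 by rewrite divr_gt0// mulr_gt0.
  by apply: ler_piMr; [exact: ltW|rewrite ler_pdivrMr; lra].
have H7 : d * r / 2 <= l^-1 * m by lra.
rewrite ler_pdivlMl// in H7.
apply: le_trans H7; rewrite powRD ?(gt_eqF r0) ?implybT// powRr1 ?(ltW r0)//.
by rewrite /l le_eqVlt; apply/orP; left; apply/eqP; ring.
Qed.

Lemma ball_mass_le_of_Linfty {R : realType} (mu : probability (measurableTypeR R) R)
    (g : R -> R) (a b M : R) :
  is_density mu g -> mu `[a, b]%classic = 1%E ->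
  {ae @lebesgue_measure R, forall x, `[a, b]%classic x -> g x <= M} ->
  exists2 C : R, 0 < C & forall x r : R, 0 < r -> r < 1 ->
    (mu (ball x r) <= (C * r)%:E)%E.
Proof.
move=> [mg g0 gE] mu1 gM; exists (2 * (`|M| + 1)).
  by rewrite mulr_gt0// ltr_wpDl.
move=> x r r0 r1.
have mB : measurable (ball x r : set R) by rewrite ball_itv; exact: measurable_itv.
have mI : measurable (`[a, b]%classic : set R) by exact: measurable_itv.
have mBI : measurable (ball x r `&` `[a, b] : set R) by exact: measurableI.
rewrite (measure_itv_cap mu1)// gE//.
apply: (@le_trans _ _ (\int[@lebesgue_measure R]_(y in ball x r `&` `[a, b])
    cst (`|M| + 1)%:E y)%E).
  apply: ae_ge0_le_integral => //.
  - by move=> y _; rewrite lee_fin.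
  - exact/measurable_EFinP/measurable_funTS.
  - by move=> y _; rewrite lee_fin addr_ge0.
  - move: gM; apply: (@filterS _ (almost_everywhere (@lebesgue_measure R)) _).
    move=> y yM [_ /yM]; rewrite lee_fin => /le_trans; apply.
    by rewrite ler_wpDr// ler_norm.
rewrite integral_cst//.
apply: (@le_trans _ _ ((`|M| + 1)%:E * (r *+ 2)%:E)%E).
  apply: lee_wpmul2l; first by rewrite lee_fin addr_ge0.
  by rewrite -(lebesgue_measure_ball x (ltW r0)); apply: le_measure; rewrite ?inE.
by rewrite -EFinM lee_fin; lra.
Qed.

Lemma ball_mass_ge_of_Linfty {R : realType} (mu : probability (measurableTypeR R) R)
    (g : R -> R) (a b M : R) :
  is_density mu g -> a < b ->
  {ae @lebesgue_measure R, forall x, `[a, b]%classic x -> 1 <= M * g x} ->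
  exists2 c : R, 0 < c & forall x, a <= x <= b -> forall r : R, 0 < r -> r < 1 ->
    ((c * r)%:E <= mu (ball x r))%E.
Proof.
move=> [mg g0 gE] ab gM.
pose d := Num.min 1 ((b - a) / 2).
have d0 : 0 < d by rewrite lt_min ltr01 divr_gt0// subr_gt0.
pose N := `|M| + 1; have N0 : 0 < N by rewrite ltr_wpDl.
exists (d / N); first by rewrite divr_gt0.
move=> x xab r r0 r1.
have mB : measurable (ball x r : set R) by rewrite ball_itv; exact: measurable_itv.
have mI : measurable (`[a, b]%classic : set R) by exact: measurable_itv.
have mBI : measurable (ball x r `&` `[a, b] : set R) by exact: measurableI.
have H1 := ball_cap_itv_measure ab xab r0 r1; rewrite -/d in H1.
have H2 : (@lebesgue_measure R (ball x r `&` `[a, b]) <=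
   \int[@lebesgue_measure R]_(y in ball x r `&` `[a, b]) (N%:E * (g y)%:E))%E.
  rewrite -[leLHS]mul1e -integral_cst//; apply: ae_ge0_le_integral => //.
  - by move=> y _; rewrite -EFinM lee_fin mulr_ge0// ltW.
  - exact/measurable_funeM/measurable_EFinP/measurable_funTS.
  - move: gM; apply: (@filterS _ (almost_everywhere (@lebesgue_measure R)) _).
    move=> y yM [_ /yM]; rewrite -EFinM lee_fin => /le_trans; apply.
    by apply: ler_wpM2r => //; rewrite /N ler_wpDr// ler_norm.
rewrite ge0_integralZl_EFin// in H2; last 3 first.
- by move=> y _; rewrite lee_fin.
- exact/measurable_EFinP/measurable_funTS.
- exact: ltW.
rewrite -gE// in H2.
have H4 : (mu (ball x r `&` `[a, b]) <= mu (ball x r))%E.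
  by apply: le_measure; rewrite ?inE//.
apply: le_trans H4; move: (le_trans H1 H2).
have -> : mu (ball x r `&` `[a, b]) = (fine (mu (ball x r `&` `[a, b])))%:E.
  by rewrite fineK// fin_num_measure.
by rewrite -EFinM !lee_fin mulrAC ler_pdivrMr// [N * _]mulrC.
Qed.

Lemma fine_inv {R : realType} (r : R) : r != 0 -> fine (r%:E^-1)%E = r^-1.
Proof. by move=> r0; rewrite inver (negbTE r0). Qed.

Lemma Lpos_ball_mass {R : realType} (mu : probability (measurableTypeR R) R)
    (a b : R) (p : \bar R) :
  ac_on a b mu -> (1 <= p)%E -> Lpos a b mu p ->
  exists2 C : R, 0 < C & forall x r : R, 0 < r -> r < 1 ->
    (mu (ball x r) <= (C * r `^ (1 - fine p^-1%E))%:E)%E.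
Proof.
move=> [mu1 mul]; have [g dg] := exists_density mul.
case: p => [q| |//].
- rewrite lee_fin => q1 /=; rewrite (integral_density_powR _ mul dg)//.
  move=> /(ball_mass_le_of_Lq dg mu1 q1); rewrite fine_inv//.
  by rewrite gt_eqF// (lt_le_trans _ q1).
- move=> _ /= [M HM].
  have [|C C0 HC] := ball_mass_le_of_Linfty dg mu1 (M := M).
    have dE := density_ae_eq mul dg.
    move: HM dE; apply: (@filterS2 _ (almost_everywhere (@lebesgue_measure R)) _).
    by move=> x /[swap] ->.
  by exists C => // x r r0 r1; rewrite subr0 powRr1 ?(ltW r0)// HC.
Qed.

Lemma measurable_zeros {R : realType} (a b : R) (f : R -> R) :
  measurable_fun [set: R] f -> measurable [set x | `[a, b]%classic x /\ f x = 0].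
Proof.
move=> mf; rewrite (_ : [set x | _ /\ _] = `[a, b]%classic `&` f @^-1` [set 0]) //.
apply: measurableI; first exact: measurable_itv.
by rewrite -[X in measurable X]setTI; exact: mf.
Qed.

Lemma measure_zeros_le {R : realType} (a b : R) (f h : R -> R) :
  measurable_fun [set: R] f -> measurable_fun [set: R] h ->
  {ae @lebesgue_measure R, forall x, f x = h x} ->
  (@lebesgue_measure R [set x | `[a, b]%classic x /\ f x = 0%R] <=
   @lebesgue_measure R [set x | `[a, b]%classic x /\ h x = 0%R])%E.
Proof.
move=> mf mh [N [mN N0 Nfh]]; rewrite -[leRHS]adde0 -N0.
apply: (@le_trans _ _ (@lebesgue_measure R
    ([set x | `[a, b]%classic x /\ h x = 0] `|` N))).
  apply: le_measure; rewrite ?inE.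
  - exact: measurable_zeros.
  - by apply: measurableU => //; exact: measurable_zeros.
  - move=> x /= [xab fx]; have [fh|fh] := pselect (f x = h x).
      by left; rewrite -fh.
    by right; apply: Nfh.
by apply: measureU2 => //; exact: measurable_zeros.
Qed.

Lemma measure_density_zeros {R : realType} (mu : probability (measurableTypeR R) R)
    (a b : R) (g : R -> R) :
  mu `<< @lebesgue_measure R -> is_density mu g ->
  @lebesgue_measure R (density_zeros a b mu) =
  @lebesgue_measure R [set x | `[a, b]%classic x /\ g x = 0].
Proof.
move=> mul dg; have dE := density_ae_eq mul dg.
have md := measurable_density mul; have mg := density_measurable dg.
apply/eqP; rewrite eq_le; apply/andP; split; apply: measure_zeros_le => //.
by move: dE; apply: (@filterS _ (almost_everywhere (@lebesgue_measure R)) _).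
Qed.

Lemma integral_off_zeros {R : realType} (mu : probability (measurableTypeR R) R)
    (a b q : R) (g : R -> R) :
  mu `<< @lebesgue_measure R -> is_density mu g ->
  @lebesgue_measure R (density_zeros a b mu) = 0%E ->
  (\int[@lebesgue_measure R]_(x in `[a, b] `\` density_zeros a b mu)
     (density mu x `^ q)%:E =
   \int[@lebesgue_measure R]_(x in `[a, b]) (g x `^ q)%:E)%E.
Proof.
move=> mul dg Z0; rewrite -(integral_density_powR _ mul dg)//.
apply/esym/ge0_negligible_integral => //.
- exact: measurable_zeros (measurable_density mul).
- apply/measurable_EFinP/measurable_funTS.
  exact: measurable_comp_powR (measurable_density mul).
- by move=> x _; rewrite lee_fin powR_ge0.
Qed.

Lemma Lneg_ball_mass {R : realType} (mu : probability (measurableTypeR R) R)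
    (a b : R) (p : \bar R) :
  a < b -> ac_on a b mu -> (1 <= p)%E -> Lneg a b mu p ->
  exists2 c : R, 0 < c & forall x, a <= x <= b -> forall r : R, 0 < r -> r < 1 ->
    ((c * r `^ (1 + fine p^-1%E))%:E <= mu (ball x r))%E.
Proof.
move=> ab [mu1 mul] p1 [Z0]; have [g dg] := exists_density mul.
have dZ0 := Z0; rewrite (measure_density_zeros _ _ mul dg) in dZ0.
case: p p1 => [q| |//].
- rewrite lee_fin => q1; have q0 : 0 < q by exact: lt_le_trans q1.
  rewrite (integral_off_zeros _ mul dg)// fine_inv ?gt_eqF// => H.
  exact: ball_mass_ge_of_Lq dg ab q0 dZ0 H.
- move=> _ /= [M HM].
  have [|c c0 Hc] := ball_mass_ge_of_Linfty dg ab (M := M).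
    have dE := density_ae_eq mul dg.
    have ZE : {ae @lebesgue_measure R, forall x, ~ density_zeros a b mu x}.
      exists (density_zeros a b mu); split => //.
        exact: measurable_zeros (measurable_density mul).
      by move=> x /= /contrapT.
    move: HM dE ZE; apply: (@filterS3 _ (almost_everywhere (@lebesgue_measure R)) _).
    move=> x HM dE nZ xab; have := HM (conj xab nZ); rewrite dE => gM.
    have gx0 : 0 < g x.
      rewrite lt_def (density_ge0 dg) andbT; apply/eqP => gx0; apply: nZ.
      by split => //; rewrite dE.
    by rewrite -ler_pdivrMr// mul1r.
  by exists c => // x xab r r0 r1; rewrite addr0 powRr1 ?(ltW r0)// Hc.
Qed.

Lemma ball_mass_bounds_of_Lpq {R : realType}
    (mu : probability (measurableTypeR R) R) (a b : R) (p1 p2 : \bar R) :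
  a < b -> ac_on a b mu -> (1 <= p1)%E -> (1 <= p2)%E ->
  Lpos a b mu p1 -> Lneg a b mu p2 ->
  ball_mass_bounds (mu : set R -> \bar R) (fine p1^-1%E) (fine p2^-1%E).
Proof.
move=> ab ac h1 h2 L1 L2; have [C C0 HC] := Lpos_ball_mass ac h1 L1.
have [c c0 Hc] := Lneg_ball_mass ab ac h2 L2.
exists C => //; exists c => // x sx r r0 r1; split; last exact: HC.
apply: Hc => //; have := msupport_itv (proj1 ac) sx.
by rewrite /= in_itv.
Qed.

Lemma itv_msupport {R : realType} (mu : probability (measurableTypeR R) R)
    (a b : R) (p : \bar R) :
  a < b -> ac_on a b mu -> (1 <= p)%E -> Lneg a b mu p ->
  `[a, b] `<=` msupport (mu : set R -> \bar R).
Proof.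
move=> ab ac p1 Lp x; rewrite /= in_itv/= => xab r r0.
have [c c0 Hc] := Lneg_ball_mass ab ac p1 Lp.
pose s := Num.min r 2^-1.
have s0 : 0 < s by rewrite lt_min r0 invr_gt0 ltr0n.
have s1 : s < 1 by rewrite gt_min orbC; apply/orP; left; lra.
apply: (@lt_le_trans _ _ (mu (ball x s))).
  apply: lt_le_trans (Hc x xab s s0 s1).
  by rewrite lte_fin mulr_gt0// powR_gt0.
apply: le_measure; rewrite ?inE ?ball_itv; try exact: measurable_itv.
rewrite -!ball_itv; apply: le_ball; by rewrite ge_min lexx.
Qed.

(** * Ahlfors regularity *)

(** Masses of balls are comparable to their radii, hence ratios of masses to
ratios of radii; as the latter are unbounded, [1] is the extreme admissible
exponent on both sides. *)
Lemma ahlfors_regular1_dims {R : realType}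
    (mu : probability (measurableTypeR R) R) (a b : R) :
  a < b -> ac_on a b mu -> Lpos a b mu +oo%E -> Lneg a b mu +oo%E ->
  [/\ ahlfors_regular1 (mu : set R -> \bar R),
      assouad_dim (mu : set R -> \bar R) = 1%E &
      lower_dim (mu : set R -> \bar R) = 1%E].
Proof.
move=> ab ac L1 L2; have y1 : (1 <= +oo :> \bar R)%E by rewrite leey.
have [C C0 [c c0 H]] := ball_mass_bounds_of_Lpq ab ac y1 y1 L1 L2.
have {}H x r : msupport (mu : set R -> \bar R) x -> 0 < r -> r < 1 ->
    ((c * r)%:E <= mu (ball x r))%E /\ (mu (ball x r) <= (C * r)%:E)%E.
  by move=> sx r0 r1; have := H x sx r r0 r1; rewrite invey /= subr0 addr0 powRr1// ltW.
have sa : msupport (mu : set R -> \bar R) a.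
  by apply: (itv_msupport ab ac y1 L2); rewrite /= in_itv/= lexx ltW.
have Cge0 s r x : 0 < r -> r < s -> s < 1 -> msupport (mu : set R -> \bar R) x ->
    ((c / C * (s / r))%:E <= mu (ball x s) / mu (ball x r))%E /\
    (mu (ball x s) / mu (ball x r) <= (C / c * (s / r))%:E)%E.
  move=> r0 rs s1 sx; have s0 := lt_trans r0 rs; have r1 := lt_trans rs s1.
  have [l1 u1] := H x s sx s0 s1; have [l2 u2] := H x r sx r0 r1.
  have cross u v : u / v * (s / r) = u * s / (v * r) by rewrite invfM mulrACA.
  rewrite !cross; split; [apply: le_ratio|apply: ratio_le] => //;
    rewrite ?mulr_gt0 ?(ltW s0) ?mulr_ge0 ?(ltW c0) ?(ltW s0)//.
  by apply: lt_le_trans l2; rewrite lte_fin mulr_gt0.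
(* arbitrarily large ratios of radii, the larger radius being [2^-1] *)
have ratios M : exists y r s : R,
    [/\ M <= y, y = s / r, 0 < r, r < s & s < 1].
  pose y := Num.max M 2; have y2 : 2 <= y by rewrite le_max lexx orbT.
  exists y, (2^-1 / y), 2^-1; split; first by rewrite le_max lexx.
  - by rewrite invf_div mulrCA divff ?mulr1// invr_eq0 pnatr_eq0.
  - by rewrite divr_gt0//; lra.
  - by rewrite ltr_pdivrMr; lra.
  - lra.
split.
- exists (Num.max 1 (Num.max C c^-1)); first by rewrite le_max lexx.
  set d := Num.max _ _.
  have [d1 dC dc] : [/\ 1 <= d, C <= d & c^-1 <= d] by rewrite !le_max !lexx ?orbT.
  move=> x sx r r0 r1; have [l u] := H x r sx r0 r1; apply/andP; split.
    apply: le_trans l; rewrite lee_fin ler_pM2r// -[leRHS]invrK lef_pV2 ?posrE ?invr_gt0//.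
    by apply: lt_le_trans d1.
  by apply: (le_trans u); rewrite lee_fin ler_pM2r.
- apply/eqP; rewrite eq_le; apply/andP; split.
    apply: ge_ereal_inf; exists 1%E => //; exists 1 => //; exists (C / c).
      exact: divr_gt0.
    move=> r s r0 rs s1 x sx; rewrite powRr1; first exact: (Cge0 _ _ _ r0 rs s1 sx).2.
    by rewrite divr_ge0// ltW// (lt_trans r0).
  apply/ereal_infP => _ [b' [K K0 bK] <-]; rewrite lee_fin.
  apply: (@powR_exponent_le _ (K / (c / C))) => M.
  have [y [r [s [My yE r0 rs s1]]]] := ratios M; exists y => //.
  have s0 := lt_trans r0 rs.
  have y0 : 0 < y by rewrite yE divr_gt0.
  rewrite powRr1 ?(ltW y0)// mulrAC ler_pdivlMr ?divr_gt0// mulrC -lee_fin yE.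
  exact: le_trans (Cge0 _ _ _ r0 rs s1 sa).1 (bK r s r0 rs s1 a sa).
- apply/eqP; rewrite eq_le; apply/andP; split.
    apply: ge_ereal_sup => _ [b' [K K0 bK] <-]; rewrite lee_fin.
    apply: (@powR_exponent_le _ ((C / c) / K)) => M.
    have [y [r [s [My yE r0 rs s1]]]] := ratios M; exists y => //.
    have s0 := lt_trans r0 rs.
    have y0 : 0 < y by rewrite yE divr_gt0.
    rewrite powRr1 ?(ltW y0)// mulrAC ler_pdivlMr// mulrC -lee_fin yE.
    exact: le_trans (bK r s r0 rs s1 a sa) (Cge0 _ _ _ r0 rs s1 sa).2.
  apply: ereal_sup_ubound; exists 1 => //; exists (c / C); first exact: divr_gt0.
  move=> r s r0 rs s1 x sx; rewrite powRr1; first exact: (Cge0 _ _ _ r0 rs s1 sx).1.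
  by rewrite divr_ge0// ltW// (lt_trans r0).
Qed.

(** * Integrals of powers *)

Lemma measurable_EFin_powR {R : realType} (D : set R) (s : R) :
  measurable_fun D (fun x : R => (x `^ s)%:E).
Proof. by apply/measurable_EFinP/measurable_funTS; exact: measurable_powR. Qed.

Lemma powR_le_dyadic {R : realType} (w x s : R) : 0 < w -> w / 2 <= x -> x < w ->
  x `^ s <= w `^ s * (1 + 2 `^ (- s)).
Proof.
move=> w0 wx xw; have x0 : 0 < x by apply: lt_le_trans wx; rewrite divr_gt0.
rewrite mulrDr mulr1; have [s0|s0] := leP 0 s.
  apply: ler_wpDr; first by rewrite mulr_ge0 ?powR_ge0.
  by rewrite ge0_ler_powR ?nnegrE ?(ltW x0) ?(ltW w0) ?(ltW xw).
apply: ler_wpDl; first exact: powR_ge0.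
have -> : w `^ s * 2 `^ (- s) = (w / 2) `^ s.
  by rewrite powRM ?(ltW w0) ?invr_ge0// -powR_inv1// -powRrM mulN1r.
rewrite -[s]opprK powRN [leRHS]powRN lef_pV2 ?posrE ?powR_gt0 ?divr_gt0//.
by rewrite ge0_ler_powR ?nnegrE ?(ltW x0) ?divr_ge0 ?(ltW w0)// oppr_ge0 ltW.
Qed.

(** The integrals over [`[v / 2 ^+ n, v[] are bounded by induction on [n], for all
[v] at once: the part below [v / 2] is the same integral at scale [v / 2], so the
bound [C * v `^ (1 + s)] is reproduced as soon as [K + C * d = C], where [K]
accounts for [`[v / 2, v[] and [d] for the change of scale. Monotone convergence
then reaches [0]. *)
Lemma integral_powR_le {R : realType} (s : R) : -1 < s ->
  exists2 C : R, 0 < C & forall w : R, 0 < w ->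
  (\int[@lebesgue_measure R]_(x in `]0%R, w[) (x `^ s)%:E <= (C * w `^ (1 + s))%:E)%E.
Proof.
move=> s1; pose K : R := 1 + 2 `^ (- s); pose d : R := 2^-1 `^ (1 + s).
have K0 : 0 < K by rewrite ltr_pwDl// powR_ge0.
have d1 : d < 1.
  by apply: powR_lt1; rewrite ?invr_gt0//; lra.
pose C := K / (1 - d); have CE : K + C * d = C by rewrite /C; field; lra.
have C0 : 0 < C by rewrite divr_gt0// subr_gt0.
exists C => // w w0.
have H n v : 0 < v ->
    (\int[@lebesgue_measure R]_(x in `[(v / 2 ^+ n)%R, v[) (x `^ s)%:E <=
      (C * v `^ (1 + s))%:E)%E.
  elim: n v => [v v0|n IH v v0].
    rewrite expr0 divr1 set_itvco0 integral_set0 lee_fin mulr_ge0 ?powR_ge0 ?(ltW C0)//.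
  have v20 : 0 < v / 2 by rewrite divr_gt0.
  have -> : `[(v / 2 ^+ n.+1)%R, v[%classic =
      `[(v / 2 / 2 ^+ n)%R, (v / 2)%R[ `|` `[(v / 2)%R, v[ :> set R.
    have v2n : v / 2 ^+ n.+1 <= v / 2.
      rewrite exprS invfM mulrA ler_piMr ?(ltW v20)//.
      by rewrite invf_le1 ?exprn_gt0// exprn_ege1// ler1n.
    rewrite exprS invfM mulrA in v2n *; apply: itv_bndbnd_setU; rewrite bnd_simp//.
    lra.
  rewrite ge0_integral_setU//=; last 3 first.
  - exact: measurable_EFin_powR.
  - by move=> x _; rewrite lee_fin powR_ge0.
  - apply/disj_setPS => x /=; rewrite !in_itv/= => -[/andP[_ x1] /andP[x2 _]].
    by move: x1; rewrite ltNge x2.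
  rewrite -[in leRHS]CE mulrDl EFinD [leRHS]addeC; apply: leeD.
    apply: le_trans (IH _ v20) _; rewrite lee_fin -mulrA; apply: ler_wpM2l; first exact: ltW.
    by rewrite powRM ?(ltW v0) ?invr_ge0// mulrC.
  apply: (@le_trans _ _ (\int[@lebesgue_measure R]_(x in `[(v / 2)%R, v[) cst (v `^ s * K)%:E x)%E).
    apply: ge0_le_integral => //.
    - by move=> x _; rewrite lee_fin powR_ge0.
    - exact: measurable_EFin_powR.
    - by move=> x; rewrite /= in_itv/= => /andP[vx xv]; rewrite lee_fin powR_le_dyadic.
  rewrite integral_cst//= lebesgue_measure_itv/= lte_fin ifT; last lra.
  rewrite -EFinB -EFinM lee_fin powRD ?(gt_eqF v0) ?implybT// powRr1 ?(ltW v0)//.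
  have : 0 <= v `^ s * K * (v / 2) by rewrite !mulr_ge0 ?powR_ge0 ?ltW.
  lra.
pose F n : set R := `[(w / 2 ^+ n)%R, w[%classic.
have -> : `]0, w[%classic = \bigcup_n F n.
  apply/seteqP; split => x; rewrite /F /= in_itv/=.
    move=> /andP[x0 xw]; exists (Num.Def.archi_bound (w / x)) => //.
    rewrite /= in_itv/= xw andbT ler_pdivrMr ?exprn_gt0// mulrC -ler_pdivrMr//.
    exact/ltW/upper_nthrootP.
  move=> [n _]; rewrite /= in_itv/= => /andP[xn ->]; rewrite andbT.
  by apply: lt_le_trans xn; rewrite divr_gt0// exprn_gt0.
have F0 i x : F i x -> (0 <= (x `^ s)%:E)%E by rewrite lee_fin powR_ge0.
have nF : nondecreasing_seq F.
  move=> m n mn; apply/subsetPset => x; rewrite /F /= !in_itv/= => /andP[x1 ->].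
  rewrite andbT; apply: le_trans x1; rewrite ler_pM2l// lef_pV2 ?posrE ?exprn_gt0//.
  by rewrite ler_weXn2l// ler1n.
have mF i : measurable (F i) by exact: measurable_itv.
have cF : (\int[@lebesgue_measure R]_(x in F n) (x `^ s)%:E @[n --> \oo] -->
    \int[@lebesgue_measure R]_(x in \bigcup_n F n) (x `^ s)%:E)%E.
  apply: ge0_nondecreasing_set_cvg_integral => //.
  by move=> n; exact: measurable_EFin_powR.
rewrite -(cvg_lim _ cF)//; apply: lime_le; first by apply/cvg_ex; eexists; exact: cF.
by apply: nearW => n; exact: H.
Qed.

(** * Measures whose density alternates between two powers *)

Section density_measure.
Context {R : realType} (g : R -> R).
Context (mg : measurable_fun [set: R] g).
Context (g0 : forall x, 0 <= g x).
Context (g1 : (\int[@lebesgue_measure R]_x (g x)%:E = 1)%E).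

Definition density_measure (A : set (measurableTypeR R)) : \bar R :=
  (\int[@lebesgue_measure R]_(x in A) (g x)%:E)%E.

Let density_measure0 : density_measure set0 = 0%E.
Proof. exact: integral_set0. Qed.

Let density_measure_ge0 A : (0 <= density_measure A)%E.
Proof. by apply: integral_ge0 => x _; rewrite lee_fin. Qed.

Let density_measure_sigma_additive : semi_sigma_additive density_measure.
Proof.
move=> /= F mF tF mUF; rewrite /density_measure; apply: cvg_toP.
  apply: ereal_nondecreasing_is_cvgn => m n mn.
  by apply: lee_sum_nneg_natr => // k _ _; exact: density_measure_ge0.
rewrite ge0_integral_bigcup//=.
- exact/measurable_EFinP/measurable_funTS.
- by move=> x _; rewrite lee_fin.
Qed.

HB.instance Definition _ := isMeasure.Build _ _ _ density_measure
  density_measure0 density_measure_ge0 density_measure_sigma_additive.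

HB.instance Definition _ := @Measure_isProbability.Build _ _ R
  density_measure g1.

Lemma density_probability : exists mu : probability (measurableTypeR R) R,
  is_density mu g.
Proof. by exists density_measure; split. Qed.

End density_measure.

Lemma is_density_dominates {R : realType}
    (mu : probability (measurableTypeR R) R) (g : R -> R) :
  is_density mu g -> mu `<< @lebesgue_measure R.
Proof.
move=> [mg g0 gE]; apply/null_content_dominatesP => A mA A0.
rewrite gE//; apply: null_set_integral => //.
exact/measurable_EFinP/measurable_funTS.
Qed.

(** Whatever [V] is, this lies between [x `^ w] and [x `^ (- u)] on [`]0, 1[], so
[V] does not affect integrability; it selects the scales at which there is much
or little mass near [0]. *)
Definition two_power_profile {R : realType} (V : set R) (u w x : R) : R :=
  \1_(`]0, 1[%classic : set R) x *
    (\1_V x * x `^ (- u) + \1_(~` V) x * x `^ w).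

Lemma measurable_two_power {R : realType} (V : set R) (u w : R) :
  measurable V -> measurable_fun [set: R] (two_power_profile V u w).
Proof.
move=> mV; apply: measurable_funM.
  by apply: measurable_indic; exact: measurable_itv.
by apply: measurable_funD; apply: measurable_funM;
  (exact: measurable_powR || apply: measurable_indic => //; exact: measurableC).
Qed.

Section two_power_profile_values.
Context {R : realType} (V : set R) (u w : R).
Context (u0 : 0 <= u).
Context (w0 : 0 <= w).
Local Notation f := (two_power_profile V u w).

Lemma two_power_in x : 0 < x -> x < 1 -> V x -> f x = x `^ (- u).
Proof.
move=> x0 x1 Vx; have x01 : `]0, 1[%classic x by rewrite /= in_itv/= x0.
have nVx : ~ (~` V) x by apply.
rewrite /two_power_profile !indicE (mem_set x01) (mem_set Vx) (memNset nVx).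
by rewrite mul0r addr0 !mul1r.
Qed.

Lemma two_power_notin x : 0 < x -> x < 1 -> ~ V x -> f x = x `^ w.
Proof.
move=> x0 x1 Vx; have x01 : `]0, 1[%classic x by rewrite /= in_itv/= x0.
have nVx : (~` V) x by [].
rewrite /two_power_profile !indicE (mem_set x01) (memNset Vx) (mem_set nVx).
by rewrite mul0r add0r !mul1r.
Qed.

Lemma two_power_out x : ~~ (0 < x < 1) -> f x = 0.
Proof.
move=> xn; rewrite /two_power_profile indicE memNset ?mul0r//=.
by rewrite in_itv/=; exact/negP.
Qed.

Lemma two_power_bounds x : 0 < x -> x < 1 -> x `^ w <= f x <= x `^ (- u).
Proof.
move=> x0 x1; have xwu : x `^ w <= x `^ (- u).
  by apply: ger_powR; [rewrite x0 ltW|apply: le_trans w0; rewrite oppr_le0].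
have [Vx|Vx] := pselect (V x).
  by rewrite two_power_in// lexx andbT.
by rewrite two_power_notin// lexx.
Qed.

Lemma two_power_ge0 x : 0 <= f x.
Proof.
have [/andP[x0 x1]|xn] := boolP (0 < x < 1); last by rewrite two_power_out.
by have /andP[+ _] := two_power_bounds x0 x1; apply: le_trans; exact: powR_ge0.
Qed.

End two_power_profile_values.

Lemma eq_integral_support {R : realType} (D S : set R) (h : R -> R) :
  S `<=` D -> (forall x, D x -> ~ S x -> h x = 0) ->
  (\int[@lebesgue_measure R]_(x in D) (h x)%:E =
   \int[@lebesgue_measure R]_(x in S) (h x)%:E)%E.
Proof.
move=> SD hS; rewrite integral_mkcond [RHS]integral_mkcond.
apply: eq_integral => x _; rewrite /patch.
have [xS|xS] := pselect (S x); first by rewrite !mem_set//; exact: SD.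
rewrite (memNset xS); case: ifPn => // /set_mem xD.
by rewrite hS.
Qed.

Lemma two_power_measure {R : realType} (V : set R) (u w : R) :
  measurable V -> 0 <= u -> u < 1 -> 0 <= w ->
  exists (mu : probability (measurableTypeR R) R) (Z : R), 0 < Z /\
    is_density mu (fun x => Z * two_power_profile V u w x).
Proof.
move=> mV u0 u1 w0; set f := two_power_profile V u w.
have mf : measurable_fun [set: R] f by exact: measurable_two_power.
have f0 x : 0 <= f x by exact: two_power_ge0.
have mEf (D : set R) : measurable_fun D (fun x => (f x)%:E).
  exact/measurable_EFinP/measurable_funTS.
have s1 : -1 < - u by rewrite ltrN2.
have [C C0 HC] := integral_powR_le s1.
have fC : (\int[@lebesgue_measure R]_x (f x)%:E <= C%:E)%E.
  rewrite (@eq_integral_support _ _ `]0, 1[%classic)//; last first.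
    by move=> x _ xn; rewrite /f two_power_out//; apply/negP; move: xn; rewrite /= in_itv.
  have := HC 1 ltr01; rewrite powR1 mulr1; apply: le_trans.
  apply: ge0_le_integral => //.
  - by move=> x _; rewrite lee_fin.
  - exact: mEf.
  - exact: measurable_EFin_powR.
  - move=> x; rewrite /= in_itv/= => /andP[x0 x1]; rewrite lee_fin.
    by have /andP[] := two_power_bounds V u0 w0 x0 x1.
have [J J0 JE] : exists2 J : R, 0 <= J & (\int[@lebesgue_measure R]_x (f x)%:E = J%:E)%E.
  apply: ge0_lty_fin; first by apply: integral_ge0 => x _; rewrite lee_fin.
  by rewrite (le_lt_trans fC)// ltry.
have Jgt0 : 0 < J.
  apply: (@lt_le_trans _ _ (2^-1 `^ w * 2^-1)).
    by rewrite mulr_gt0 ?powR_gt0 ?invr_gt0.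
  rewrite -lee_fin -JE.
  apply: (@le_trans _ _ (\int[@lebesgue_measure R]_(x in `[(2^-1)%R, 1%R[) (f x)%:E)%E); last first.
    apply: ge0_subset_integral => //; first exact: mEf.
    by move=> x _; rewrite lee_fin.
  apply: (@le_trans _ _ (\int[@lebesgue_measure R]_(x in `[(2^-1)%R, 1%R[) cst (2^-1 `^ w)%:E x)%E).
    rewrite integral_cst//= lebesgue_measure_itv/= lte_fin ifT; last lra.
    by rewrite -EFinB -EFinM lee_fin ler_wpM2l ?powR_ge0//; lra.
  apply: ge0_le_integral => //.
  - by move=> x _; rewrite lee_fin powR_ge0.
  - exact: mEf.
  - move=> x; rewrite /= in_itv/= => /andP[x2 x1]; rewrite lee_fin.
    have x0 : 0 < x by apply: lt_le_trans x2; rewrite invr_gt0.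
    have /andP[+ _] := two_power_bounds V u0 w0 x0 x1; apply: le_trans.
    by rewrite ge0_ler_powR ?nnegrE ?invr_ge0 ?(ltW x0).
have [|||mu dmu] := @density_probability R (fun x => J^-1 * f x).
- exact: measurable_funM.
- by move=> x; rewrite mulr_ge0// invr_ge0.
- under eq_integral do rewrite EFinM.
  rewrite ge0_integralZl_EFin ?invr_ge0//.
  + by rewrite JE -EFinM mulVf// gt_eqF.
  + by move=> x _; rewrite lee_fin.
  + exact: mEf.
- by exists mu, J^-1; split => //; rewrite invr_gt0.
Qed.

Section two_power_measure_theory.
Context {R : realType} (V : set R) (u w Z : R) (mV : measurable V) (u0 : 0 <= u)
  (u1 : u < 1) (w0 : 0 <= w) (Z0 : 0 < Z)
  (mu : probability (measurableTypeR R) R)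
  (dmu : is_density mu (fun x => Z * two_power_profile V u w x)).
Local Notation f := (two_power_profile V u w).

Let f_bounds x (x0 : 0 < x) (x1 : x < 1) := two_power_bounds V u0 w0 x0 x1.

Let f_off x : ~ `]0, 1[%classic x -> f x = 0.
Proof.
by move=> xn; rewrite two_power_out//; apply/negP; move: xn; rewrite /= in_itv.
Qed.

Let mf : measurable_fun [set: R] f.
Proof. exact: measurable_two_power. Qed.

Let mZf : measurable_fun [set: R] (fun x => Z * f x).
Proof. exact: measurable_funM. Qed.

Lemma two_power_ac_on : ac_on 0 1 mu.
Proof.
split; last exact: is_density_dominates dmu.
rewrite -(probability_setT mu) !(density_integral dmu)//.
rewrite (@eq_integral_support _ _ `]0, 1[%classic); first last.
- by move=> x _ /f_off ->; rewrite mulr0.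
- by move=> x; rewrite /= !in_itv/= => /andP[x0 x1]; rewrite !ltW.
by rewrite [RHS](@eq_integral_support _ _ `]0, 1[%classic)// => x _ /f_off ->; rewrite mulr0.
Qed.

Let integral_density_lty (q s K : R) : q != 0 -> -1 < s -> 0 <= K ->
  (forall x, 0 < x -> x < 1 -> (Z * f x) `^ q <= K * x `^ s) ->
  (\int[@lebesgue_measure R]_(x in `[0%R, 1%R]) ((Z * f x) `^ q)%:E < +oo)%E.
Proof.
move=> q0 s1 K0 H; rewrite (@eq_integral_support _ _ `]0, 1[%classic); first last.
- by move=> x _ /f_off ->; rewrite mulr0 powR0.
- by move=> x; rewrite /= !in_itv/= => /andP[x0 x1]; rewrite !ltW.
have [C C0 /(_ 1 ltr01) HC] := integral_powR_le s1.
apply: (@le_lt_trans _ _ (\int[@lebesgue_measure R]_(x in `]0%R, 1%R[)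
    (K%:E * (x `^ s)%:E))%E).
  apply: ge0_le_integral => //.
  - by move=> x _; rewrite lee_fin powR_ge0.
  - apply/measurable_EFinP/measurable_funTS.
    exact: measurable_comp_powR mZf.
  - by apply: measurable_funeM; exact: measurable_EFin_powR.
  - by move=> x; rewrite /= in_itv/= => /andP[x0 x1]; rewrite -EFinM lee_fin H.
rewrite ge0_integralZl_EFin//; last 2 first.
- by move=> x _; rewrite lee_fin powR_ge0.
- exact: measurable_EFin_powR.
rewrite (@le_lt_trans _ _ (K%:E * (C * 1 `^ (1 + s))%:E)%E)//.
  by apply: lee_wpmul2l; rewrite ?lee_fin.
by rewrite -EFinM ltry.
Qed.

Lemma two_power_Lpos (q : R) : 1 <= q -> q * u < 1 -> Lpos 0 1 mu q%:E.
Proof.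
move=> q1 qu; have q0 : 0 < q by apply: lt_le_trans q1.
rewrite /Lpos (integral_density_powR _ two_power_ac_on.2 dmu)//.
apply: (@integral_density_lty _ (- (q * u)) (Z `^ q)).
- by rewrite gt_eqF.
- by rewrite ltrN2.
- exact: powR_ge0.
- move=> x x0 x1; rewrite powRM ?two_power_ge0 ?(ltW Z0)//.
  apply: ler_wpM2l; first exact: powR_ge0.
  rewrite mulrC -mulNr powRrM; have /andP[_ H] := f_bounds x0 x1.
  by rewrite ge0_ler_powR ?nnegrE ?two_power_ge0 ?powR_ge0 ?(ltW q0).
Qed.

Lemma two_power_Lneg (q : R) : 1 <= q -> q * w < 1 -> Lneg 0 1 mu q%:E.
Proof.
move=> q1 qw; have q0 : 0 < q by apply: lt_le_trans q1.
have z0 : @lebesgue_measure R (density_zeros 0 1 mu) = 0%E.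
  rewrite (measure_density_zeros _ _ two_power_ac_on.2 dmu).
  apply/eqP; rewrite -measure_le0.
  rewrite -[leRHS](_ : @lebesgue_measure R ([set 0] `|` [set 1]) = 0%E); last first.
    by rewrite measureU0; do ?[exact: measurable_set1 | exact: lebesgue_measure_set1].
  apply: le_measure; rewrite ?inE.
  - exact: measurable_zeros mZf.
  - exact: measurableU.
  - move=> x [/=]; rewrite in_itv/= !le_eqVlt => /andP[/orP[/eqP <-|x0]]; first by left.
    move=> /orP[/eqP ->|x1]; first by right.
    have /andP[H _] := f_bounds x0 x1.
    move=> /eqP; rewrite mulf_eq0 gt_eqF//= gt_eqF//.
    by apply: lt_le_trans H; rewrite powR_gt0.
split => //.
rewrite (integral_off_zeros (- q) two_power_ac_on.2 dmu z0).
apply: (@integral_density_lty _ (- (q * w)) (Z `^ (- q))).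
- by rewrite oppr_eq0 gt_eqF.
- by rewrite ltrN2.
- exact: powR_ge0.
- move=> x x0 x1; rewrite powRM ?two_power_ge0 ?(ltW Z0)//.
  apply: ler_wpM2l; first exact: powR_ge0.
  rewrite mulrC -mulrN powRrM; have /andP[H _] := f_bounds x0 x1.
  have xw : 0 < x `^ w by rewrite powR_gt0.
  rewrite !powRN lef_pV2 ?posrE ?powR_gt0 ?(lt_le_trans xw H)//.
  by rewrite ge0_ler_powR ?nnegrE ?two_power_ge0 ?powR_ge0 ?(ltW q0).
Qed.

Lemma two_power_mass_ge (l h : R) : 0 < l -> l <= h / 2 -> h <= 1 ->
  `[l, h[ `<=` V ->
  ((Z / 2 * h `^ (1 - u))%:E <= mu (ball 0%R h))%E.
Proof.
move=> l0 lh h1 hV; have h0 : 0 < h by lra.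
have mI : measurable (`[l, h[%classic : set R) by exact: measurable_itv.
apply: (@le_trans _ _ (mu `[l, h[%classic)); last first.
  apply: le_measure; rewrite ?inE// ?ball_itv; first exact: measurable_itv.
  by move=> x; rewrite sub0r add0r /= !in_itv/= => /andP[lx ->]; rewrite andbT; lra.
rewrite (density_integral dmu)//.
apply: (@le_trans _ _ (\int[@lebesgue_measure R]_(x in `[l, h[) cst (Z * h `^ (- u))%:E x)%E).
  rewrite integral_cst//= lebesgue_measure_itv/= lte_fin ifT; last lra.
  rewrite -EFinB -EFinM lee_fin powRD ?(gt_eqF h0) ?implybT// powRr1 ?(ltW h0)//.
  rewrite -mulrA [h * _]mulrC -!mulrA ler_pM2l// mulrCA ler_pM2l ?powR_gt0//; lra.
apply: ge0_le_integral => //.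
- by move=> x _; rewrite lee_fin mulr_ge0 ?powR_ge0 ?ltW.
- exact/measurable_EFinP/measurable_funTS.
- move=> x lxh; move: (lxh); rewrite /= in_itv/= => /andP[lx xh].
  have x0 : 0 < x by apply: lt_le_trans lx.
  rewrite lee_fin ler_pM2l// two_power_in//; [|lra|exact: hV].
  rewrite !powRN lef_pV2 ?posrE ?powR_gt0//.
  by rewrite ge0_ler_powR ?nnegrE ?(ltW x0) ?(ltW h0) ?(ltW xh).
Qed.

(** The profile is small on [`[l, h[]; below [l] only the bound by [x `^ (- u)] is
used, which costs little when [l] is much smaller than [h]. *)
Lemma two_power_mass_le : exists2 C : R, 0 < C &
  forall l h : R, 0 < l -> l <= h -> h <= 1 -> (forall x, l <= x -> x < h -> ~ V x) ->
  (mu (ball 0%R h) <= (C * (l `^ (1 - u) + h `^ (1 + w)))%:E)%E.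
Proof.
have s1 : -1 < - u by rewrite ltrN2.
have [C C0 HC] := integral_powR_le s1.
exists (Z * (C + 1)); first by rewrite mulr_gt0//; lra.
move=> l h l0 lh h1 hV; have h0 : 0 < h by lra.
have mI : measurable (`[l, h[%classic : set R) by exact: measurable_itv.
have mJ : measurable (`]0%R, l[%classic : set R) by exact: measurable_itv.
have mD (D : set R) : measurable_fun D (fun x => (Z * f x)%:E).
  exact/measurable_EFinP/measurable_funTS.
have D0 (D : set R) x : D x -> (0 <= (Z * f x)%:E)%E.
  by move=> _; rewrite lee_fin mulr_ge0 ?two_power_ge0// ltW.
rewrite (density_integral dmu); last by rewrite ball_itv; exact: measurable_itv.
apply: (@le_trans _ _ (\int[@lebesgue_measure R]_(x in `]0%R, l[ `|` `[l, h[)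
    (Z * f x)%:E)%E).
  rewrite (@eq_integral_support _ _ (`]0, l[ `|` `[l, h[)%classic)//.
  - rewrite ball_itv sub0r add0r => x /= [] /=; rewrite !in_itv/= => /andP[x0 xl];
      apply/andP; split; lra.
  - rewrite ball_itv sub0r add0r => x /=; rewrite in_itv/= => /andP[_ xh] xn.
    rewrite f_off ?mulr0//= in_itv/= => /andP[x0 _]; apply: xn.
    by have [xl|lx] := ltP x l; [left|right]; rewrite /= in_itv/= ?x0 ?xl ?lx.
rewrite ge0_integral_setU//=; last 3 first.
- exact: mD.
- by move=> x _; exact: (D0 setT).
- apply/disj_setPS => x /=; rewrite !in_itv/= => -[/andP[_ x1] /andP[x2 _]].
  by move: x1; rewrite ltNge x2.
apply: (@le_trans _ _ ((Z * C * l `^ (1 - u))%:E + (Z * h `^ (1 + w))%:E)%E); last first.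
  rewrite -EFinD lee_fin.
  have [] : 0 <= Z * C * h `^ (1 + w) /\ 0 <= Z * l `^ (1 - u).
    by rewrite !mulr_ge0 ?powR_ge0 ?ltW.
  lra.
apply: leeD.
- apply: (@le_trans _ _ (\int[@lebesgue_measure R]_(x in `]0%R, l[)
      (Z%:E * (x `^ (- u))%:E))%E).
    apply: ge0_le_integral => //.
    + by move=> x; exact: D0.
    + exact: mD.
    + by apply: measurable_funeM; exact: measurable_EFin_powR.
    + move=> x; rewrite /= in_itv/= => /andP[x0 xl]; rewrite -EFinM lee_fin ler_pM2l//.
      have x1 : x < 1 by lra.
      by have /andP[] := f_bounds x0 x1.
  rewrite ge0_integralZl_EFin ?(ltW Z0)//; last 2 first.
  + by move=> x _; rewrite lee_fin powR_ge0.
  + exact: measurable_EFin_powR.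
  by rewrite -mulrA EFinM; apply: lee_wpmul2l; [rewrite lee_fin ltW|exact: HC].
- apply: (@le_trans _ _ (\int[@lebesgue_measure R]_(x in `[l, h[) cst (Z * h `^ w)%:E x)%E).
    apply: ge0_le_integral => //.
    + by move=> x; exact: D0.
    + exact: mD.
    + move=> x; rewrite /= in_itv/= => /andP[lx xh]; rewrite lee_fin ler_pM2l//.
      have x0 : 0 < x by lra.
      rewrite two_power_notin//; [|lra|exact: hV].
      by rewrite ge0_ler_powR ?nnegrE ?(ltW x0) ?(ltW h0) ?(ltW xh).
  rewrite integral_cst//.
  apply: (@le_trans _ _ ((Z * h `^ w)%:E * h%:E)%E); last first.
    by rewrite -EFinM lee_fin powRD ?(gt_eqF h0) ?implybT// powRr1 ?(ltW h0)// -mulrA (mulrC h).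
  apply: lee_wpmul2l; first by rewrite lee_fin mulr_ge0 ?powR_ge0 ?ltW.
  rewrite /= lebesgue_measure_itv/= lte_fin; case: ifP => _; rewrite -?EFinB lee_fin; lra.
Qed.

End two_power_measure_theory.

(** * Rapidly decreasing scales *)

(** Scales separated by more than any fixed power: [radius n.+1] is the [n.+1]-st
power of [radius n]. *)
Definition radius {R : realType} (n : nat) : R := 2^-1 ^+ n`!.

Section radius_theory.
Context {R : realType}.
Local Notation rad := (@radius R).

Lemma radius_gt0 n : 0 < rad n.
Proof. by rewrite exprn_gt0// invr_gt0. Qed.

Lemma radius_le_half n : rad n <= 2^-1.
Proof.
rewrite -[leRHS]expr1 ler_wiXn2l ?invr_ge0 ?fact_gt0//.
by rewrite invf_le1// ler1n.
Qed.

Lemma radius_lt1 n : rad n < 1.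
Proof. by apply: le_lt_trans (radius_le_half n) _; rewrite invf_lt1// ltr1n. Qed.

Lemma radiusS n : rad n.+1 = rad n `^ n.+1%:R.
Proof. by rewrite powR_mulrn ?(ltW (radius_gt0 n))// -exprM mulnC -factS. Qed.

Lemma le_radius m n : (m <= n)%N -> rad n <= rad m.
Proof.
move=> mn; rewrite ler_wiXn2l ?invr_ge0//; first by rewrite invf_le1// ler1n.
by rewrite leq_fact.
Qed.

Lemma le_radius_powR n (a b : R) : a <= b -> rad n `^ b <= rad n `^ a.
Proof. by move=> ab; apply: ger_powR => //; rewrite radius_gt0 ltW// radius_lt1. Qed.

Lemma exists_radius_lt (d M : R) : 0 < d -> exists n : nat, rad n < d /\ M <= n%:R.
Proof.
move=> d0; exists (maxn (Num.Def.archi_bound d^-1) (Num.Def.archi_bound `|M|)).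
set n := maxn _ _; split.
  apply: (@le_lt_trans _ _ (2^-1 ^+ n)).
    by rewrite ler_wiXn2l ?invr_ge0 ?fact_geq// invf_le1// ler1n.
  rewrite exprVn invf_plt ?posrE ?exprn_gt0//.
  by apply: upper_nthrootP; exact: leq_maxl.
apply: (le_trans (ler_norm M)); apply/ltW/(lt_le_trans (archi_boundP (normr_ge0 M))).
by rewrite ler_nat leq_maxr.
Qed.

End radius_theory.

(** * Limits of exponents *)

Lemma ball_mass_boundsW {R : realType} (mu : set R -> \bar R) (v w v' w' : R) :
  v <= v' -> w <= w' -> ball_mass_bounds mu v w -> ball_mass_bounds mu v' w'.
Proof.
move=> vv ww [C C0 [c c0 H]]; exists C => //; exists c => // x sx r r0 r1.
have [l u] := H x sx r r0 r1; split.
  apply: le_trans l; rewrite lee_fin ler_pM2l//.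
  by apply: ger_powR; [rewrite r0 ltW|rewrite lerD2l].
apply: (le_trans u); rewrite lee_fin ler_pM2l//.
by apply: ger_powR; [rewrite r0 ltW|rewrite lerD2l lerN2].
Qed.

Lemma spectra_bounds_limit {R : realType} (mu : set R -> \bar R) (v w t : R) :
  (forall A, 0 <= mu A)%E -> 0 < t < 1 ->
  (forall e, 0 < e -> ball_mass_bounds mu (v + e) (w + e)) ->
  (assouad_spectrum t mu <= (1 + (w + t * v) / (1 - t))%:E)%E /\
  ((1 - (t * w + v) / (1 - t))%:E <= lower_spectrum t mu)%E.
Proof.
move=> mu0 t01 H; have /andP[t0 t1] := t01.
have t1' : 0 < 1 - t by lra.
have tn0 : 1 - t != 0 by rewrite gt_eqF.
have tp0 : 1 + t != 0 by rewrite gt_eqF//; lra.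
pose f e := e * (1 - t) / (1 + t).
have f0 e : 0 < e -> 0 < f e by move=> e0; rewrite divr_gt0 ?mulr_gt0//; lra.
split; apply/lee_addgt0Pr => e e0.
  apply: (le_trans (assouad_spectrum_le mu0 t01 (H _ (f0 e e0)))).
  rewrite -EFinD lee_fin le_eqVlt; apply/orP; left; apply/eqP.
  by rewrite /f; field; rewrite tn0.
apply: le_trans (leeD (le_lower_spectrum t01 (H _ (f0 e e0))) (lexx e%:E)).
rewrite -EFinD lee_fin le_eqVlt; apply/orP; left; apply/eqP.
by rewrite /f; field; rewrite tn0.
Qed.

Lemma inv_exponent {R : realType} (p : \bar R) : (1 < p)%E ->
  [/\ 0 <= fine p^-1%E, fine p^-1%E < 1,
     (forall q : R, 1 <= q -> (q%:E < p)%E -> q * fine p^-1%E < 1) &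
     forall e : R, 0 < e -> exists q : R,
       [/\ 1 <= q, (q%:E < p)%E & q^-1 <= fine p^-1%E + e]].
Proof.
have main (r : R) : 0 <= r -> r < 1 -> (forall q : R, 1 <= q -> q * r < 1 -> (q%:E < p)%E) ->
    forall e : R, 0 < e -> exists q : R, [/\ 1 <= q, (q%:E < p)%E & q^-1 <= r + e].
  move=> r0 r1 H e e0; pose v := Num.min (r + e) 1.
  have rv : r < v by rewrite lt_min r1 andbT ltrDl.
  have v1 : v <= 1 by rewrite ge_min lexx orbT.
  have v0 : 0 < v by exact: le_lt_trans rv.
  have q1 : 1 <= v^-1 by rewrite invf_ge1.
  exists v^-1; split => //; last by rewrite invrK ge_min lexx.
  by apply: H => //; rewrite mulrC ltr_pdivrMr// mul1r.
case: p main => [p| |//] main.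
- rewrite lte_fin => p1; have p0 : 0 < p by apply: lt_trans p1.
  rewrite fine_inv ?gt_eqF//.
  have H1 : p^-1 < 1 by rewrite invf_lt1.
  have H0 : 0 <= p^-1 by rewrite invr_ge0 ltW.
  split => //; first by move=> q q1; rewrite lte_fin ltr_pdivrMr// mul1r.
  by apply: main => // q q1; rewrite lte_fin ltr_pdivrMr// mul1r.
- move=> _; rewrite invey /=; split => //; first by move=> q _ _; rewrite mulr0.
  by apply: main => // q q1 _; rewrite ltry.
Qed.

(** The bounds for [q1 < p1] and [q2 < p2] depend continuously on [q1^-1] and
[q2^-1], so they pass to the limit [p1], [p2] even if the density is not
integrable to these limit powers. *)
Lemma spectra_bounds_of_Lpq_lt {R : realType}
    (mu : probability (measurableTypeR R) R) (a b t : R) (p1 p2 : \bar R) :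
  a < b -> ac_on a b mu -> (1 < p1)%E -> (1 < p2)%E -> 0 < t < 1 ->
  (forall q1 q2 : R, 1 <= q1 -> (q1%:E < p1)%E -> 1 <= q2 -> (q2%:E < p2)%E ->
     Lpos a b mu q1%:E /\ Lneg a b mu q2%:E) ->
  (assouad_spectrum t (mu : set R -> \bar R)
     <= (1 + (fine p2^-1%E + t * fine p1^-1%E) / (1 - t))%:E)%E /\
  ((1 - (t * fine p2^-1%E + fine p1^-1%E) / (1 - t))%:E
     <= lower_spectrum t (mu : set R -> \bar R))%E.
Proof.
move=> ab ac h1 h2 t01 H; apply: spectra_bounds_limit => //.
move=> e e0; have [_ _ _ /(_ e e0)[q1 [q11 q1p q1e]]] := inv_exponent h1.
have [_ _ _ /(_ e e0)[q2 [q21 q2p q2e]]] := inv_exponent h2.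
have [L1 L2] := H q1 q2 q11 q1p q21 q2p.
have q1n0 : q1 != 0 by rewrite gt_eqF// (lt_le_trans _ q11).
have q2n0 : q2 != 0 by rewrite gt_eqF// (lt_le_trans _ q21).
have := ball_mass_bounds_of_Lpq ab ac (p1 := q1%:E) (p2 := q2%:E) q11 q21 L1 L2.
by rewrite !fine_inv//; exact: ball_mass_boundsW.
Qed.

(** * Extremal measures *)

Lemma exists_two_power_measure {R : realType} (V : set R) (u w : R) :
  measurable V -> 0 <= u -> u < 1 -> 0 <= w -> w < 1 ->
  exists mu : probability (measurableTypeR R) R, exists2 c : R, 0 < c &
  exists2 C : R, 0 < C &
    [/\ [/\ ac_on 0 1 mu,
            forall q : R, 1 <= q -> q * u < 1 -> Lpos 0 1 mu q%:E &
            forall q : R, 1 <= q -> q * w < 1 -> Lneg 0 1 mu q%:E],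
        msupport (mu : set R -> \bar R) 0,
        forall l h : R, 0 < l -> l <= h / 2 -> h <= 1 -> `[l, h[ `<=` V ->
          ((c * h `^ (1 - u))%:E <= mu (ball 0%R h))%E &
        forall l h : R, 0 < l -> l <= h -> h <= 1 ->
          (forall x, l <= x -> x < h -> ~ V x) ->
          (mu (ball 0%R h) <= (C * (l `^ (1 - u) + h `^ (1 + w)))%:E)%E].
Proof.
move=> mV u0 u1 w0 w1; have [mu [Z [Z0 dmu]]] := two_power_measure mV u0 u1 w0.
have ac := two_power_ac_on dmu.
have Lp := two_power_Lpos mV u0 w0 Z0 dmu.
have Ln := two_power_Lneg mV u0 w0 Z0 dmu.
have [C C0 HC] := two_power_mass_le mV u0 u1 w0 Z0 dmu.
exists mu, (Z / 2); first exact: divr_gt0.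
have s0 : msupport (mu : set R -> \bar R) 0.
  have L1 : Lneg 0 1 mu 1%:E by apply: Ln; rewrite ?mul1r.
  have p1 : (1 <= 1 :> \bar R)%E by [].
  by apply: (itv_msupport ltr01 ac p1 L1); rewrite /= in_itv/= lexx ler01.
exists C => //; split; [by split|exact: s0| |exact: HC].
exact (two_power_mass_ge mV u0 Z0 dmu).
Qed.

(** Put much mass just below each radius [R = radius n], on [`[R / 2, R[], and
little mass elsewhere. The ball of radius [R] around [0] then has mass of order
[R `^ (1 - u)]. For large [n], the radius [r = R `^ (1 / t)] lies in the gap
between [radius n.+1] and [R / 2], and so far above [radius n.+1] that the mass
below the gap is negligible: the ball of radius [r] has mass of order
[r `^ (1 + w)]. *)
Lemma assouad_extremal {R : realType} (u w : R) :
  0 <= u -> u < 1 -> 0 <= w -> w < 1 ->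
  exists mu : probability (measurableTypeR R) R,
  [/\ ac_on 0 1 mu,
      forall q : R, 1 <= q -> q * u < 1 -> Lpos 0 1 mu q%:E,
      forall q : R, 1 <= q -> q * w < 1 -> Lneg 0 1 mu q%:E &
      forall t : R, 0 < t < 1 ->
        ((1 + (w + t * u) / (1 - t))%:E <= assouad_spectrum t (mu : set R -> \bar R))%E].
Proof.
move=> u0 u1 w0 w1; pose V : set R := \bigcup_n `[(radius n / 2), radius n[%classic.
have u1' : 0 < 1 - u by rewrite subr_gt0.
have mV : measurable V.
  by apply: bigcupT_measurable => n; exact: measurable_itv.
have [mu [c c0 [C C0 [[ac Lp Ln] s0 mge mle]]]] := exists_two_power_measure mV u0 u1 w0 w1.
exists mu; split => // t t01; have /andP[t0 t1] := t01.
have C20 : 0 < 2 * C by rewrite mulr_gt0.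
have K0 : 0 < c / (2 * C) by rewrite divr_gt0.
apply: (le_assouad_spectrum t01 K0) => d d0.
have [d2 d20 Hd2] := self_ratio_unbounded 2 t01.
have dd0 : 0 < Num.min d d2 by rewrite lt_min d0.
have [n [nd nM]] := exists_radius_lt ((1 + w) / (t * (1 - u))) dd0.
move: nd; rewrite lt_min => /andP[nd nd2].
have rn0 := @radius_gt0 R n; have rn1 := @radius_lt1 R n.
exists (radius n), 0; split => //.
have /= := Hd2 _ rn0 nd2.
set r := radius n `^ (1 / t); have r0 : 0 < r by rewrite powR_gt0.
rewrite ler_pdivlMr// => rs.
rewrite ler_pdivrMr ?mulr_gt0// in nM.
have nt : 0 <= n%:R * t by rewrite mulr_ge0// ltW.
have ntu : 0 <= n%:R * t * u by rewrite mulr_ge0.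
have tu : 0 < t * (1 - u) by rewrite mulr_gt0.
(* [r] is in the gap, and [radius n.+1 `^ (1 - u) <= r `^ (1 + w)] *)
have n1 : 1 / t <= n.+1%:R by rewrite ler_pdivrMr// -natr1; lra.
have n2 : (1 + w) / t <= n.+1%:R * (1 - u).
  by rewrite ler_pdivrMr// -natr1; lra.
have lr : radius n.+1 <= r by rewrite radiusS le_radius_powR.
have lrp : radius n.+1 `^ (1 - u) <= r `^ (1 + w).
  by rewrite radiusS /r -!powRrM mul1r le_radius_powR// [leLHS]mulrC.
have ub : (mu (ball 0%R r) <= (2 * C * r `^ (1 + w))%:E)%E.
  apply: (le_trans (mle _ _ (radius_gt0 _) lr _ _)); first lra.
    move=> x lx xr [k _]; rewrite /= in_itv/= => /andP[kx xk].
    have [kn|nk] := leqP k n; first by have := le_radius (R := R) kn; lra.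
    by have := le_radius (R := R) nk; lra.
  rewrite lee_fin; nra.
have lb : ((c * radius n `^ (1 - u))%:E <= mu (ball 0%R (radius n)))%E.
  apply: (mge (radius n / 2)) => //; [exact: divr_gt0|exact: ltW|].
  by move=> x; exists n.
apply: le_trans (le_ratio _ _ _ lb ub); last 3 first.
- by rewrite mulr_ge0 ?powR_ge0// ltW.
- by rewrite mulr_gt0// powR_gt0.
- exact: s0.
rewrite powR_self_ratio// /r -powRrM lee_fin le_eqVlt; apply/orP; left; apply/eqP.
rewrite [in RHS]invfM [in RHS]mulrACA; congr (_ * _).
rewrite -powRB ?(gt_eqF rn0) ?implybT//.
by congr (_ `^ _); field; rewrite subr_eq0 !gt_eqF.
Qed.

(** Put much mass on [`[radius n.+1, R `^ k[] for [R = radius n], and little mass on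
[`[R `^ k, R[]. The exponent [k] is such that the mass [(R `^ k) `^ (1 - u)] of
the heavy part is [R `^ (1 + w)], so that the ball of radius [R] still has mass
of order [R `^ (1 + w)]. The ball of radius [r = R `^ (1 / t)] has mass of order
[r `^ (1 - u)] if [r <= R `^ k]. Otherwise it contains the whole heavy part and
the ratio of masses is bounded: this is where the maximum with [0] comes from. *)
Lemma lower_extremal {R : realType} (u w : R) :
  0 <= u -> u < 1 -> 0 <= w -> w < 1 ->
  exists mu : probability (measurableTypeR R) R,
  [/\ ac_on 0 1 mu,
      forall q : R, 1 <= q -> q * u < 1 -> Lpos 0 1 mu q%:E,
      forall q : R, 1 <= q -> q * w < 1 -> Lneg 0 1 mu q%:E &
      forall t : R, 0 < t < 1 ->
        (lower_spectrum t (mu : set R -> \bar R) <=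
          (Num.max (1 - (t * w + u) / (1 - t)) 0)%:E)%E].
Proof.
move=> u0 u1 w0 w1; pose k := (1 + w) / (1 - u).
pose V : set R := \bigcup_n `[radius n.+1, radius n `^ k[%classic.
have u1' : 0 < 1 - u by rewrite subr_gt0.
have mV : measurable V.
  by apply: bigcupT_measurable => n; exact: measurable_itv.
have [mu [c c0 [C C0 [[ac Lp Ln] s0 mge mle]]]] := exists_two_power_measure mV u0 u1 w0 w1.
exists mu; split => // t t01; have /andP[t0 t1] := t01.
have C20 : 0 < 2 * C by rewrite mulr_gt0.
have K0 : 0 < 2 * C / c by rewrite divr_gt0.
apply: (lower_spectrum_le t01 K0) => d d0.
(* [R `^ e] is the smaller of the radii [r] and [R `^ k] *)
pose e := Num.max (1 / t) k.
have [n [nd nM]] := exists_radius_lt e d0.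
have rn0 := @radius_gt0 R n; have rn1 := @radius_lt1 R n.
exists (radius n), 0; split => //.
set r := radius n `^ (1 / t); have r0 : 0 < r by rewrite powR_gt0.
have k1 : 1 <= k by rewrite ler_pdivlMr//; lra.
have kE : k * (1 - u) = 1 + w by rewrite divfK// gt_eqF.
have ub : (mu (ball 0%R (radius n)) <= (2 * C * radius n `^ (1 + w))%:E)%E.
  have := mle (radius n `^ k) (radius n); rewrite -powRrM kE => H.
  apply: (le_trans (H _ _ _ _)); rewrite ?powR_gt0 ?(ltW rn1)//.
  - by apply: ge1r_powR; rewrite ?rn0 ?(ltW rn1).
  - move=> x kx xn [j _]; rewrite /= in_itv/= => /andP[jx xj].
    have [jn|nj] := ltnP j n; first by have := le_radius (R := R) jn; lra.
    have : radius j `^ k <= radius n `^ k.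
      by rewrite ge0_ler_powR ?nnegrE ?(ltW (radius_gt0 _)) ?le_radius//; lra.
    by lra.
  - by rewrite lee_fin; lra.
pose h := radius n `^ e; have h0 : 0 < h by rewrite powR_gt0.
have hr : h <= r by rewrite le_radius_powR// le_max lexx.
have hk : h <= radius n `^ k by rewrite le_radius_powR// le_max lexx orbT.
have r1 : r < 1 by rewrite powR_lt1// divr_gt0.
have lb : ((c * h `^ (1 - u))%:E <= mu (ball 0%R r))%E.
  apply: (@le_trans _ _ (mu (ball 0%R h))); last first.
    by apply: le_measure; rewrite ?inE;
    [by rewrite ball_itv; exact: measurable_itv..|exact: le_ball].
  apply: (mge (radius n.+1)) => //; [exact: radius_gt0| |lra|].
    apply: (@le_trans _ _ (radius n `^ (e + 1))).
      by rewrite radiusS le_radius_powR// -natr1 lerD2r.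
    rewrite powRD ?(gt_eqF rn0) ?implybT// powRr1 ?(ltW rn0)//.
    by rewrite ler_pM2l// radius_le_half.
  move=> x; rewrite /= in_itv/= => /andP[nx xh]; exists n => //=.
  by rewrite in_itv/= nx /=; lra.
have h1u : 0 < c * h `^ (1 - u) by rewrite mulr_gt0// powR_gt0.
apply: (le_trans (ratio_le h1u _ ub lb)) => //.
rewrite powR_self_ratio// /h -powRrM lee_fin le_eqVlt; apply/orP; left; apply/eqP.
rewrite [in LHS]invfM [in LHS]mulrACA; congr (_ * _).
rewrite -powRB ?(gt_eqF rn0) ?implybT//; congr (_ `^ _).
have t1' : 0 < 1 - t by lra.
have aE : (1 - (t * w + u) / (1 - t)) * (1 - t) = (1 - u) - t * (1 + w).
  by field; rewrite gt_eqF.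
have [kt|tk] := leP k (1 / t).
  have -> : e = 1 / t by rewrite /e; apply/max_idPl.
  rewrite (max_idPl _); first by field; rewrite subr_eq0 !gt_eqF.
  rewrite -(pmulr_lge0 _ t1') aE subr_ge0.
  by move: kt; rewrite ler_pdivrMr// mulrAC ler_pdivlMr// mul1r mulrC.
have -> : e = k by rewrite /e; apply/max_idPr/ltW.
rewrite kE subrr (max_idPr _) ?mulr0//.
rewrite -(pmulr_lle0 _ t1') aE subr_le0.
by move: tk; rewrite ltr_pdivlMr// mulrAC ltr_pdivrMr// mul1r mulrC => /ltW.
Qed.

(** * Bounds for the spectra and their sharpness *)

Theorem theorem2p1 (R : realType) :
  (forall (a b : R) (mu : probability (measurableTypeR R) R) (p1 p2 : \bar R),
    a < b -> ac_on a b mu -> (1 <= p1)%E -> (1 <= p2)%E ->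
    Lpos a b mu p1 -> Lneg a b mu p2 ->
    [/\ (forall q1 q2 : R, p1 = q1%:E -> p2 = q2%:E ->
          forall t : R, 0 < t < 1 ->
            (assouad_spectrum t (mu : set R -> \bar R)
               <= (1 + (q1 + t * q2) / (q1 * q2 * (1 - t)))%:E)%E /\
            ((1 - (t * q1 + q2) / (q1 * q2 * (1 - t)))%:E
               <= lower_spectrum t (mu : set R -> \bar R))%E),
        (p1 = +oo%E -> p2 = +oo%E ->
          [/\ ahlfors_regular1 (mu : set R -> \bar R),
              assouad_dim (mu : set R -> \bar R) = 1%E &
              lower_dim (mu : set R -> \bar R) = 1%E]),
        (forall q1 : R, p1 = q1%:E -> p2 = +oo%E ->
          forall t : R, 0 < t < 1 ->
            (assouad_spectrum t (mu : set R -> \bar R)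
               <= (1 + t / (q1 * (1 - t)))%:E)%E /\
            ((1 - 1 / (q1 * (1 - t)))%:E
               <= lower_spectrum t (mu : set R -> \bar R))%E) &
        (forall q2 : R, p1 = +oo%E -> p2 = q2%:E ->
          forall t : R, 0 < t < 1 ->
            (assouad_spectrum t (mu : set R -> \bar R)
               <= (1 + 1 / (q2 * (1 - t)))%:E)%E /\
            ((1 - t / (q2 * (1 - t)))%:E
               <= lower_spectrum t (mu : set R -> \bar R))%E)]) /\
  (forall p1 p2 : \bar R, (1 < p1)%E -> (1 < p2)%E ->
    (exists (a b : R) (mu : probability (measurableTypeR R) R),
      [/\ a < b, ac_on a b mu,
          (forall q1 q2 : R, 1 <= q1 -> (q1%:E < p1)%E ->
             1 <= q2 -> (q2%:E < p2)%E ->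
             Lpos a b mu q1%:E /\ Lneg a b mu q2%:E) &
          (forall t : R, 0 < t < 1 ->
             assouad_spectrum t (mu : set R -> \bar R) =
             (1 + (fine p2^-1%E + t * fine p1^-1%E) / (1 - t))%:E)]) /\
    (exists (a b : R) (mu : probability (measurableTypeR R) R),
      [/\ a < b, ac_on a b mu,
          (forall q1 q2 : R, 1 <= q1 -> (q1%:E < p1)%E ->
             1 <= q2 -> (q2%:E < p2)%E ->
             Lpos a b mu q1%:E /\ Lneg a b mu q2%:E) &
          (forall t : R, 0 < t < 1 ->
             lower_spectrum t (mu : set R -> \bar R) =
             (Num.max (1 - (t * fine p2^-1%E + fine p1^-1%E) / (1 - t)) 0)%:E)])).
Proof.
split=> [a b mu p1 p2 ab ac h1 h2 L1 L2|p1 p2 h1 h2].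
- have B := ball_mass_bounds_of_Lpq ab ac h1 h2 L1 L2.
  have U t : 0 < t < 1 -> (assouad_spectrum t (mu : set R -> \bar R) <=
      (1 + (fine p2^-1%E + t * fine p1^-1%E) / (1 - t))%:E)%E.
    by move=> t01; apply: assouad_spectrum_le.
  have L t : 0 < t < 1 -> ((1 - (t * fine p2^-1%E + fine p1^-1%E) / (1 - t))%:E <=
      lower_spectrum t (mu : set R -> \bar R))%E.
    by move=> t01; apply: le_lower_spectrum.
  have nz (q : R) : (1 <= q%:E :> \bar R)%E -> q != 0.
    by rewrite lee_fin => q1; rewrite gt_eqF// (lt_le_trans _ q1).
  have nz1 (t : R) : 0 < t < 1 -> 1 - t != 0.
    by move=> /andP[_ t1]; rewrite gt_eqF// subr_gt0.
  split.
  + move=> q1 q2 e1 e2 t t01; move: (U t t01) (L t t01) h1 h2.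
    rewrite {}e1 {}e2 => {}U {}L /nz q1n0 /nz q2n0; have tn0 := nz1 t t01.
    rewrite !fine_inv// in U L.
    have -> : (q1 + t * q2) / (q1 * q2 * (1 - t)) = (q2^-1 + t * q1^-1) / (1 - t).
      by field; rewrite tn0 q1n0 q2n0.
    have -> : (t * q1 + q2) / (q1 * q2 * (1 - t)) = (t * q2^-1 + q1^-1) / (1 - t).
      by field; rewrite tn0 q1n0 q2n0.
    by [].
  + by move=> e1 e2; move: L1 L2; rewrite e1 e2; exact: ahlfors_regular1_dims.
  + move=> q1 e1 e2 t t01; move: (U t t01) (L t t01) h1.
    rewrite {}e1 {}e2 => {}U {}L /nz q1n0; have tn0 := nz1 t t01.
    rewrite invey fine_inv//= ?add0r ?mulr0 ?add0r in U L.
    have -> : t / (q1 * (1 - t)) = t * q1^-1 / (1 - t) by field; rewrite tn0 q1n0.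
    have -> : 1 / (q1 * (1 - t)) = q1^-1 / (1 - t) by field; rewrite tn0 q1n0.
    by [].
  + move=> q2 e1 e2 t t01; move: (U t t01) (L t t01) h2.
    rewrite {}e1 {}e2 => {}U {}L /nz q2n0; have tn0 := nz1 t t01.
    rewrite invey fine_inv//= ?mulr0 ?addr0 in U L.
    have -> : t / (q2 * (1 - t)) = t * q2^-1 / (1 - t) by field; rewrite tn0 q2n0.
    have -> : 1 / (q2 * (1 - t)) = q2^-1 / (1 - t) by field; rewrite tn0 q2n0.
    by [].
have [u0 u1 pu _] := inv_exponent h1; have [w0 w1 pw _] := inv_exponent h2.
split.
- have [mu [ac Lp Ln H]] := assouad_extremal u0 u1 w0 w1.
  have Lpn (q1 q2 : R) : 1 <= q1 -> (q1%:E < p1)%E -> 1 <= q2 -> (q2%:E < p2)%E ->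
      Lpos 0 1 mu q1%:E /\ Lneg 0 1 mu q2%:E.
    by move=> q11 q1p q21 q2p; split; [apply: Lp|apply: Ln] => //; [exact: pu|exact: pw].
  exists 0, 1, mu; split => // t t01; apply/eqP; rewrite eq_le H// andbT.
  by have [] := spectra_bounds_of_Lpq_lt ltr01 ac h1 h2 t01 Lpn.
- have [mu [ac Lp Ln H]] := lower_extremal u0 u1 w0 w1.
  have Lpn (q1 q2 : R) : 1 <= q1 -> (q1%:E < p1)%E -> 1 <= q2 -> (q2%:E < p2)%E ->
      Lpos 0 1 mu q1%:E /\ Lneg 0 1 mu q2%:E.
    by move=> q11 q1p q21 q2p; split; [apply: Lp|apply: Ln] => //; [exact: pu|exact: pw].
  exists 0, 1, mu; split => // t t01; apply/eqP; rewrite eq_le H//=.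
  rewrite EFin_max ge_max lower_spectrum_ge0// andbT.
  by have [] := spectra_bounds_of_Lpq_lt ltr01 ac h1 h2 t01 Lpn.
Qed.
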